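(* Let $\alpha\in(0,1]$, $\lambda>0$ and $p\in(0,1/2)$. Let $L^{(1)}_{\alpha,\lambda}(t)$ be the single time-fractional queue with parameters $\alpha,\lambda,p$, and let $\pi$ be the probability distribution on $\{0,1,2,\dots\}$ given by $\pi_j=\frac{1-2p}{1-p}\left(\frac{p}{1-p}\right)^{j}$. Assume that the initial queue length distribution $\mu_0$ is finitely supported. Then there exist positive constants $\varepsilon_0$ and $U_{\alpha,\lambda,\mu_0}$ such that $$T^{\varepsilon}_{\rm mix}=\inf\big\{t>0:\ \|\mathbb P_{\mu_0}\{L^{(1)}_{\alpha,\lambda}(t)\in\cdot\}-\pi\|_{TV}\le\varepsilon\big\}\le U_{\alpha,\lambda,\mu_0}\,\varepsilon^{-1/\alpha}\qquad\text{for all }0<\varepsilon<\varepsilon_0 .$$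
   Context: Mittag-Leffler function: $E_{a,b}(x)=\sum_{\ell\ge 0}\frac{x^{\ell}}{\Gamma(b+a\ell)}$. For $\alpha\in(0,1]$ and $\lambda>0$, a Mittag-Leffler random variable $X_{\alpha,\lambda}$ with index $\alpha$ and scale $\lambda$ is positive with $\mathbb P\{X_{\alpha,\lambda}>x\}=E_{\alpha,1}(-\lambda^{\alpha}x^{\alpha})$, $x\ge0$. The fractional Poisson process $N^{(\alpha)}_{\lambda}(t)$ is the renewal counting process (with $N^{(\alpha)}_\lambda(0)=0$ and a renewal at time $0$) whose inter-event times are i.i.d. copies of $X_{\alpha,\lambda}$. Discrete queue: $(Q_n)_{n\ge0}$ is the Markov chain on $\{0,1,2,\dots\}$ with transition probabilities $q_{k,k+1}=p$ and $q_{k,k-1}=1-p$ for $k\ge1$, and $q_{0,1}=p$, $q_{0,0}=1-p$. For $p<1/2$ its unique equilibrium distribution is $\pi$. The single time-fractional queue is $L^{(1)}_{\alpha,\lambda}(t)=Q_{N^{(\alpha)}_{\lambda}(t)}$, where $(Q_n)$ is independent of $N^{(\alpha)}_\lambda$. $\mathbb P_{\mu_0}$ denotes the law when $Q_0\sim\mu_0$. Total variation distance on $\mathbb N_0$: $\|\mu-\nu\|_{TV}=\sup_{A}|\mu(A)-\nu(A)|=\frac12\sum_{x\in\mathbb N_0}|\mu(x)-\nu(x)|$. *)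

(* Defs.v *)
From mathcomp Require Import all_boot all_order all_algebra finmap.
From mathcomp Require Import all_classical all_reals all_analysis.

Set Implicit Arguments.
Unset Strict Implicit.
Unset Printing Implicit Defensive.

Import Order.TTheory GRing.Theory Num.Theory.
Import numFieldNormedType.Exports.

Local Open Scope classical_set_scope.
Local Open Scope ring_scope.

(* Used below only at [s >= 1], where the integral is finite. *)
Definition gamma_fun {R : realType} (s : R) : R :=
  \int[lebesgue_measure]_(x in `]0, +oo[) (x `^ (s - 1) * expR (- x)).

Definition mittag_leffler {R : realType} (a b x : R) : R :=
  limn (series (fun l : nat => x ^+ l / gamma_fun (b + a * l%:R))).

Definition mittag_leffler_rv {R : realType} (alpha lambda : R)
    (d : measure_display) (T : measurableType d) (P : probability T R)
    (X : T -> R) : Prop :=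
  {ae P, forall w, 0 < X w} /\
  (forall x : R, 0 <= x ->
     P [set w | x < X w] =
     (mittag_leffler alpha 1 (- (lambda `^ alpha * x `^ alpha)))%:E).

Definition mutually_independent {R : realType} (d d' : measure_display)
    (T : measurableType d) (T' : measurableType d') (P : probability T R)
    (X : nat -> T -> T') : Prop :=
  forall (J : {fset nat}) (B : nat -> set T'), (forall i, measurable (B i)) ->
    P (\bigcap_(i in [set` J]) (X i @^-1` B i)) =
    (\prod_(i <- J) P (X i @^-1` B i))%E.

(* The number of n >= 1 such that X 0 + ... + X (n - 1) <= t, so that the
   renewal at time 0 is not counted. [fset_set] sends an infinite set to the
   empty one: the value is then 0, which for i.i.d. positive [X] happens with
   probability 0. *)
Definition renewal_count {R : realType} (T : Type) (X : nat -> T -> R)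
    (t : R) (w : T) : nat :=
  #|` fset_set [set n : nat | \sum_(i < n.+1) X i w <= t] |%fset.

Definition process_sigma (I T : Type) (d' : measure_display)
    (T' : measurableType d') (D : set I) (Y : I -> T -> T') : set (set T) :=
  <<s [set A | exists i, D i /\ exists2 B, measurable B & A = Y i @^-1` B] >>.

Definition independent_sigma {R : realType} (d : measure_display)
    (T : measurableType d) (P : probability T R) (F G : set (set T)) : Prop :=
  forall A B, F A -> G B -> P (A `&` B) = (P A * P B)%E.

(* As [0.-1 = 0], a queue in state 0 stays there with probability [1 - p]. *)
Definition queue_trans {R : realType} (p : R) (i j : nat) : R :=
  if j == i.+1 then p else if j == i.-1 then 1 - p else 0.

(* Division-free form of
   P(Q_{n+1} = x_{n+1} | Q_0 = x_0, ..., Q_n = x_n) = q(x_n, x_{n+1}). *)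
Definition markov_chain {R : realType} (d : measure_display)
    (T : measurableType d) (P : probability T R) (mu0 : set nat -> \bar R)
    (q : nat -> nat -> R) (Q : nat -> T -> nat) : Prop :=
  (forall k, P (Q 0 @^-1` [set k]) = mu0 [set k]) /\
  (forall (n : nat) (x : nat -> nat),
     P [set w | forall i, (i <= n.+1)%N -> Q i w = x i] =
     (P [set w | forall i, (i <= n)%N -> Q i w = x i]
      * (q (x n) (x n.+1))%:E)%E).

Definition fractional_queue {R : realType} (T : Type)
    (X : nat -> T -> R) (Q : nat -> T -> nat) (t : R) (w : T) : nat :=
  Q (renewal_count X t w) w.

Definition fractional_queue_data {R : realType} (alpha lambda p : R)
    (mu0 : set nat -> \bar R) (d : measure_display) (T : measurableType d)
    (P : probability T R) (X : nat -> T -> R) (Q : nat -> T -> nat) : Prop :=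
  [/\ forall n, mittag_leffler_rv alpha lambda P (X n),
      mutually_independent P X,
      markov_chain P mu0 (queue_trans p) Q &
      independent_sigma P (process_sigma [set: nat] Q)
        (process_sigma [set t : R | 0 <= t] (renewal_count X))].

Definition queue_equilibrium {R : realType} (p : R) (A : set nat) : \bar R :=
  \esum_(j in A) ((1 - p *+ 2) / (1 - p) * (p / (1 - p)) ^+ j)%:E.

Definition tv_dist {R : realType} (d : measure_display) (T : measurableType d)
    (mu nu : set T -> \bar R) : \bar R :=
  ereal_sup [set `|mu A - nu A|%E | A in measurable].

(* Extended-real valued: it is [+oo] if the level [eps] is never reached. *)
Definition mixing_time {R : realType} (d : measure_display)
    (T : measurableType d) (mu : R -> set T -> \bar R) (nu : set T -> \bar R)
    (eps : R) : \bar R :=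
  ereal_inf [set t%:E | t in
    [set t : R | 0 < t /\ (tv_dist (mu t) nu <= eps%:E)%E]].

(* Main.v *)
Require Import Defs.
From mathcomp Require Import all_boot all_order all_algebra finmap.
From mathcomp Require Import all_classical all_reals all_analysis.
From mathcomp Require Import measurable_realfun.
From mathcomp Require Import ring lra zify.
Set Implicit Arguments.
Unset Strict Implicit.
Unset Printing Implicit Defensive.
Import Order.TTheory GRing.Theory Num.Theory.
Import numFieldNormedType.Exports.
Local Open Scope classical_set_scope.
Local Open Scope ring_scope.

(** The law of the queue at time t is the mixture, over the number N(t) = n of
    renewals, of the laws of the discrete chain after n steps. Two facts give
    the rate t^-alpha for the distance to equilibrium, hence the bound
    eps^(-1/alpha) on the mixing time.

    The discrete chain converges geometrically
    ([queue_geometric_ergodicity]). The transition operator acts on the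
    increments h(k+1) - h(k) of a function h as a walk killed at 0, for which
    k |-> r^k is a strict supersolution as soon as 1 < r < (1-p)/p. The
    increments after n steps are therefore at most rho^n r^k with rho < 1, and
    the equilibrium has a geometric tail light enough to integrate r^k.

    Few renewals before t are unlikely ([prob_renewal_count_power_le]):
    N(t) = n almost surely forces one of the first n+1 waiting times to exceed
    t/(n+1), so that P(N(t) = n) is at most (n+1) P(X > t/(n+1)). The factor
    rho^n absorbs the polynomial factors in n, and all that remains is the
    decay in t of the tail of one waiting time, E_alpha(-x) <= C / x with
    x = (lambda t)^alpha.

    This decay ([ml_decay]) uses that E_alpha(-x) is nonincreasing with values
    in [0,1], being a tail function. For m with alpha m >= 1, integrating the
    power series of E_alpha(-x u^alpha) term by term against a Beta density in
    u of parameters 1 and alpha m shifts its coefficients by m, because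
    B(a,b) = Gamma(a) Gamma(b) / Gamma(a+b). What comes out is, up to the
    factor (-x)^-m, the series without its first m terms. Since
    E_alpha(-x u^alpha) >= E_alpha(-x) on [0,1], the result is
    c x^m E_alpha(-x) <= |E_alpha(-x) - (first m terms)| = O(x^(m-1)).

    The constants are to be chosen before the probability space, whereas it is
    the existence of waiting times that makes E_alpha(-x) a tail function. The
    proof of the theorem therefore distinguishes two cases: if E_alpha(-x) is
    not a tail function, no waiting times have this law and the bound holds
    vacuously. *)

(** * The Gamma and Beta integrals *)

Lemma preimage_scale_itv (R : realType) (k : R) (b1 b2 : bool) (x y : R) :
  0 < k ->
  ( *%R k) @^-1` [set` Interval (BSide b1 x) (BSide b2 y)] =
  [set` Interval (BSide b1 (k^-1 * x)) (BSide b2 (k^-1 * y))].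
Proof.
move=> k0; apply/seteqP; split => z /=;
  rewrite !itv_boundlr => /andP[h1 h2]; apply/andP; split; move: h1 h2;
  case: b1; case: b2; rewrite !bnd_simp;
  by rewrite ?ler_pdivrMl ?ler_pdivlMl ?ltr_pdivrMl ?ltr_pdivlMl.
Qed.

Lemma ge0_integral_scale (R : realType) (k : R) (f : R -> \bar R) :
  0 < k -> measurable_fun [set: R] f -> (forall x : R, (0 <= f x)%E) ->
  (\int[lebesgue_measure]_x f x =
   k%:E * \int[lebesgue_measure]_x f (k * x)%R)%E.
Proof.
move=> k0 mf f0.
have mk : measurable_fun [set: measurableTypeR R]
    ( *%R k : measurableTypeR R -> measurableTypeR R).
  exact: measurable_funM.
pose kn := NngNum (ltW k0).
pose g : measurableTypeR R -> \bar R := f.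
pose pf := measure_function_pushforward__canonical__measure_function_Measure
  (@lebesgue_measure R) mk.
transitivity (\int[mscale kn pf]_x g x)%E.
  apply: eq_measure_integral => A mA _.
  apply: (lebesgue_measure_unique (mu := mscale kn pf)) => // _ [[a b]] _ <-.
  transitivity (k%:E * lebesgue_measure
      (`](k^-1 * a)%R, (k^-1 * b)%R]%classic : set R))%E; last first.
    by rewrite -(preimage_scale_itv false false a b k0).
  rewrite !lebesgue_measure_itv/=.
  rewrite !lte_fin ltr_pM2l ?invr_gt0//.
  case: ifPn => _; last by rewrite mule0.
  by rewrite -!EFinB -EFinM -mulrBr mulrA divff ?mul1r ?gt_eqF.
by rewrite ge0_integral_mscale//= ge0_integral_pushforward//.
Qed.

(** Integrands are set to 0 off ]0, +oo[, so that dilations and Tonelli's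
    theorem can be used on the whole line. *)
Definition gamma_density {R : realType} (s x : R) : R :=
  \1_(`]0, +oo[ : set R) x * (x `^ s * expR (- x)).

(** The Beta integrand in the coordinate v = 1/u - 1: its integral is
    B(a + 1, b + 1). With this coordinate the product formula only involves
    dilations, and no integral with a variable endpoint. *)
Definition beta_prime_density {R : realType} (a b v : R) : R :=
  \1_(`]0, +oo[ : set R) v * (v `^ b * (1 + v) `^ (- (a + b + 2))).

Lemma indic_gt0 (R : realType) (x : R) :
  0 < x -> \1_(`]0, +oo[ : set R) x = 1 :> R.
Proof. by move=> x0; rewrite indicE mem_set//= in_itv/= x0. Qed.

Lemma indic_le0 (R : realType) (x : R) :
  x <= 0 -> \1_(`]0, +oo[ : set R) x = 0 :> R.
Proof. by move=> x0; rewrite indicE memNset//= in_itv/= andbT ltNge x0. Qed.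

Lemma gamma_density_ge0 (R : realType) (s x : R) : 0 <= gamma_density s x.
Proof. by rewrite /gamma_density !mulr_ge0 ?powR_ge0 ?expR_ge0. Qed.

Lemma beta_prime_density_ge0 (R : realType) (a b v : R) :
  0 <= beta_prime_density a b v.
Proof. by rewrite /beta_prime_density !mulr_ge0 ?powR_ge0. Qed.

Lemma measurable_gamma_density (R : realType) (s : R) :
  measurable_fun [set: R] (gamma_density s).
Proof.
apply: measurable_funM; first exact: measurable_indic.
apply: measurable_funM; first exact: measurable_powR.
by apply: measurableT_comp => //; exact: oppr_measurable.
Qed.

Lemma measurable_beta_prime_density (R : realType) (a b : R) :
  measurable_fun [set: R] (beta_prime_density a b).
Proof.
apply: measurable_funM; first exact: measurable_indic.
apply: measurable_funM; first exact: measurable_powR.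
apply: (measurableT_comp (measurable_powR _)).
exact: measurable_funD.
Qed.

(** From ln (c x) < c x with c = 1 / (2 (s + 1)): the exponential e^(-x) of the
    Gamma integrand beats the power with a factor e^(-x/2) to spare. *)
Lemma powR_le_expR_half (R : realType) (s x : R) : 0 <= s -> 0 < x ->
  x `^ s <= expR (- s * ln (2^-1 / (s + 1))) * expR (x / 2).
Proof.
move=> s0 x0; have s1 : 0 < s + 1 by lra.
rewrite /powR gt_eqF// -expRD ler_expR.
set c := _ / _; have c0 : 0 < c by rewrite divr_gt0.
have : ln (c * x) < c * x by apply: ln_sublinear; rewrite mulr_gt0.
rewrite lnM ?posrE// => h.
have h2 : s * (ln c + ln x) <= s * (c * x) by rewrite ler_wpM2l// ltW.
have h3 : s * (c * x) <= x / 2.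
  have -> : s * (c * x) = (s / (s + 1)) * (x / 2).
    by rewrite /c; field; lra.
  by rewrite ger_pMl ?divr_gt0// ler_pdivrMr//; lra.
by rewrite mulNr; lra.
Qed.

Lemma integrable_gamma_density (R : realType) (s : R) : 0 <= s ->
  lebesgue_measure.-integrable [set: R] (EFin \o gamma_density s).
Proof.
move=> s0.
pose K : R := expR (- s * ln (2^-1 / (s + 1))) * 2.
have h2 : (0 : R) < 2^-1 by [].
apply: (@le_integrable _ _ R lebesgue_measure _ measurableT _
  (fun x => (K%:E * (exponential_pdf 2^-1 x)%:E)%E)) => //.
- by apply/measurable_EFinP; exact: measurable_gamma_density.
- move=> x _ /=; rewrite lee_fin ger0_norm ?gamma_density_ge0//.
  apply: le_trans (ler_norm _).
  rewrite /gamma_density; case: (ltP 0 x) => x0; last first.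
    rewrite indic_le0// mul0r mulr_ge0//.
      by rewrite mulr_ge0 ?expR_ge0.
    exact/exponential_pdf_ge0/ltW.
  rewrite indic_gt0// mul1r (exponential_pdfE _ (ltW x0)).
  apply: (@le_trans _ _
      ((expR (- s * ln (2^-1 / (s + 1))) * expR (x / 2)) * expR (- x))).
    by rewrite ler_wpM2r ?expR_ge0// powR_le_expR_half.
  rewrite /K -!mulrA ler_pM2l ?expR_gt0// !mulrA mulfV// mul1r -expRD.
  by rewrite ler_expR; lra.
- by apply: integrableZl => //; exact: integrable_exponential_pdf.
Qed.

(** Euler's Gamma function at s + 1: the shift turns the arguments that are at
    least 1 into the half line 0 <= s. *)
Definition Gamma1 {R : realType} (s : R) : R :=
  \int[lebesgue_measure]_x gamma_density s x.

Lemma gamma_fun1D (R : realType) (s : R) : gamma_fun (1 + s) = Gamma1 s.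
Proof.
rewrite /gamma_fun /Gamma1 /Rintegral; congr fine.
rewrite integral_mkcond; apply: eq_integral => x _.
rewrite /restrict /gamma_density indicE (_ : 1 + s - 1 = s); last by ring.
by case: ifPn => _; rewrite ?mul1r ?mul0r.
Qed.

Lemma Gamma1E (R : realType) (s : R) : 0 <= s ->
  (\int[lebesgue_measure]_x (gamma_density s x)%:E = (Gamma1 s)%:E)%E.
Proof.
move=> s0; rewrite /Gamma1 /Rintegral fineK//.
exact: (integrable_fin_num _ (integrable_gamma_density s0)).
Qed.

(** The part of the integral over [M, M+1] alone. As M is free, the Gamma
    function outgrows every geometric sequence, which makes the Mittag-Leffler
    series entire. *)
Lemma Gamma1_lower (R : realType) (s M : R) : 0 <= s -> 0 < M ->
  M `^ s * expR (- (M + 1)) <= Gamma1 s.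
Proof.
move=> s0 M0; rewrite -lee_fin -Gamma1E//.
set c := _ * _; have c0 : 0 <= c by rewrite mulr_ge0 ?powR_ge0 ?expR_ge0.
have -> : c%:E = (\int[lebesgue_measure]_(x in `[M, (M + 1)%R]) (cst c%:E x))%E.
  rewrite integral_cst//= lebesgue_measure_itv/= lte_fin ltrDl ltr01.
  by rewrite -EFinB (_ : M + 1 - M = 1) ?mule1//; ring.
rewrite integral_mkcond; apply: ge0_le_integral => //=.
- by move=> x _; rewrite patchE; case: ifP => // _; rewrite lee_fin.
- apply/(measurable_restrictT _ _).1 => //.
- by apply/measurable_EFinP; exact: measurable_gamma_density.
- move=> x _; rewrite patchE; case: ifPn => [|_]; last first.
    by rewrite lee_fin gamma_density_ge0.
  rewrite inE/= in_itv/= => /andP[Mx xM]; rewrite lee_fin /gamma_density.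
  rewrite indic_gt0 ?(lt_le_trans M0)// mul1r /c ler_pM ?powR_ge0 ?expR_ge0//.
    by apply: ge0_ler_powR; rewrite // nnegrE ltW// (lt_le_trans M0).
  by rewrite ler_expR lerN2.
Qed.

Lemma Gamma1_gt0 (R : realType) (s : R) : 0 <= s -> 0 < Gamma1 s.
Proof.
move=> s0; apply: lt_le_trans (Gamma1_lower s0 ltr01).
by rewrite mulr_gt0 ?powR_gt0 ?expR_gt0.
Qed.

Opaque Gamma1.

Lemma powRD_gt0 (R : realType) (x r s : R) :
  0 < x -> x `^ (r + s) = x `^ r * x `^ s.
Proof. by move=> x0; rewrite powRD// (gt_eqF x0) implybT. Qed.

Lemma indic_gt0_pMl (R : realType) (k x : R) : 0 < k ->
  \1_(`]0, +oo[ : set R) (k * x) = \1_(`]0, +oo[ : set R) x :> R.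
Proof.
move=> k0; case: (ltP 0 x) => x0; first by rewrite !indic_gt0// mulr_gt0.
by rewrite !indic_le0// pmulr_rle0.
Qed.

(** The pointwise identity behind the product formula: the left side is the
    product of two Gamma integrands after the dilation y = x v of the second
    variable; the right side is ready for the dilation x |-> (1 + v) x. *)
Lemma gamma_density_convolution (R : realType) (a b x v : R) :
  0 <= a -> 0 <= b ->
  gamma_density a x * x * gamma_density b (x * v) =
  \1_(`]0, +oo[ : set R) v *
  (v `^ b * (1 + v) `^ (- (a + b + 1)) * gamma_density (a + b + 1) ((1 + v) * x)).
Proof.
move=> a0 b0; rewrite /gamma_density.
case: (ltP 0 v) => v0; last first.
  rewrite (indic_le0 v0) mul0r.
  case: (ltP 0 x) => x0; last by rewrite (indic_le0 x0) !mul0r.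
  by rewrite indic_gt0_pMl// (indic_le0 v0) !mul0r mulr0.
have v1 : 0 < 1 + v by rewrite addr_gt0.
rewrite (indic_gt0_pMl _ v1) (indic_gt0 v0).
case: (ltP 0 x) => x0; last by rewrite (indic_le0 x0) !mul0r !mulr0.
rewrite (indic_gt0_pMl _ x0) (indic_gt0 x0) (indic_gt0 v0) !mul1r.
rewrite !powRM ?ltW// powRN.
rewrite (_ : - ((1 + v) * x) = - x + - (x * v)); last by ring.
rewrite expRD (powRD_gt0 (a + b) 1 x0) (powRD_gt0 a b x0) powRr1 ?ltW//.
by field; rewrite gt_eqF ?powR_gt0.
Qed.

(** Tonelli applied to [gamma_density_convolution]: integrating in v first gives
    the product of the Gamma integrals, integrating in x first gives the Beta
    integral. *)
Lemma Gamma1_beta (R : realType) (a b : R) : 0 <= a -> 0 <= b ->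
  ((Gamma1 a)%:E * (Gamma1 b)%:E =
   (Gamma1 (a + b + 1))%:E *
   \int[lebesgue_measure]_v (beta_prime_density a b v)%:E)%E.
Proof.
move=> a0 b0.
have ab0 : 0 <= a + b + 1 by rewrite !addr_ge0.
pose F (z : R * R) : \bar R :=
  (gamma_density a z.1 * z.1 * gamma_density b (z.1 * z.2))%:E.
have mF : measurable_fun [set: R * R] F.
  apply/measurable_EFinP; apply: measurable_funM.
    apply: measurable_funM; last exact: measurable_fst.
    exact: (measurableT_comp (measurable_gamma_density _) measurable_fst).
  apply: (measurableT_comp (measurable_gamma_density _)).
  by apply: measurable_funM; [exact: measurable_fst|exact: measurable_snd].
have gx0 s (x : R) : 0 <= gamma_density s x * x.
  case: (ltP 0 x) => x0; first by rewrite mulr_ge0 ?gamma_density_ge0 ?ltW.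
  by rewrite /gamma_density (indic_le0 x0) !mul0r.
have F0 z : (0 <= F z)%E.
  by rewrite lee_fin mulr_ge0 ?gx0 ?gamma_density_ge0.
have mg s k : measurable_fun [set: R] (fun x => (gamma_density s (k * x))%:E).
  apply/measurable_EFinP.
  by apply: (measurableT_comp (measurable_gamma_density _)); exact: measurable_funM.
have := fubini_tonelli (m1 := lebesgue_measure) (m2 := lebesgue_measure) F mF F0.
have -> : (\int[lebesgue_measure]_x \int[lebesgue_measure]_v F (x, v) =
    \int[lebesgue_measure]_x ((gamma_density a x)%:E * (Gamma1 b)%:E))%E.
  apply: eq_integral => x _.
  case: (ltP 0 x) => x0; last first.
    rewrite integral0_eq ?mul0e//; last first.
      by move=> v _; rewrite /F /gamma_density (indic_le0 x0) !mul0r.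
    by rewrite /gamma_density (indic_le0 x0) mul0r mul0e.
  rewrite -Gamma1E// [in RHS](ge0_integral_scale x0)//; last 2 first.
  - by apply/measurable_EFinP; exact: measurable_gamma_density.
  - by move=> v; rewrite lee_fin gamma_density_ge0.
  rewrite muleA -EFinM -ge0_integralZl//.
  - exact: mg.
  - by move=> v _; rewrite lee_fin gamma_density_ge0.
  - by rewrite lee_fin gx0.
have -> : (\int[lebesgue_measure]_v \int[lebesgue_measure]_x F (x, v) =
    \int[lebesgue_measure]_v
      ((Gamma1 (a + b + 1))%:E * (beta_prime_density a b v)%:E))%E.
  apply: eq_integral => v _.
  under eq_integral do rewrite /F/= gamma_density_convolution//.
  case: (ltP 0 v) => v0; last first.
    rewrite integral0_eq; last by move=> x _; rewrite (indic_le0 v0) mul0r.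
    by rewrite /beta_prime_density (indic_le0 v0) mul0r mule0.
  have v1 : 0 < 1 + v by rewrite addr_gt0.
  under eq_integral do rewrite (indic_gt0 v0) mul1r EFinM.
  rewrite ge0_integralZl//; last 3 first.
  - exact: mg.
  - by move=> x _; rewrite lee_fin gamma_density_ge0.
  - by rewrite lee_fin mulr_ge0// powR_ge0.
  rewrite -Gamma1E// [in RHS](ge0_integral_scale v1); last 2 first.
  - by apply/measurable_EFinP; exact: measurable_gamma_density.
  - by move=> x; rewrite lee_fin gamma_density_ge0.
  rewrite muleAC -EFinM /beta_prime_density (indic_gt0 v0) mul1r.
  congr (_ %:E * _)%E; rewrite mulrCA; congr (_ * _).
  rewrite (_ : - (a + b + 1) = 1 + - (a + b + 2)); last by ring.
  by rewrite powRD_gt0// powRr1 ?ltW.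
rewrite ge0_integralZr//; last 3 first.
- by apply/measurable_EFinP; exact: measurable_gamma_density.
- by move=> x _; rewrite lee_fin gamma_density_ge0.
- by rewrite lee_fin ltW// Gamma1_gt0.
rewrite ge0_integralZl//; last 3 first.
- by apply/measurable_EFinP; exact: measurable_beta_prime_density.
- by move=> x _; rewrite lee_fin beta_prime_density_ge0.
- by rewrite lee_fin ltW// Gamma1_gt0.
by rewrite Gamma1E.
Qed.

Lemma integral_beta_prime (R : realType) (a b : R) : 0 <= a -> 0 <= b ->
  (\int[lebesgue_measure]_v (beta_prime_density a b v)%:E =
   (Gamma1 a * Gamma1 b / Gamma1 (a + b + 1))%:E)%E.
Proof.
move=> a0 b0; have ab0 : 0 < Gamma1 (a + b + 1) by rewrite Gamma1_gt0// !addr_ge0.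
rewrite mulrC EFinM EFinM Gamma1_beta// muleA -EFinM mulVf ?mul1e//.
by rewrite gt_eqF.
Qed.

Lemma integrable_beta_prime (R : realType) (a b : R) : 0 <= a -> 0 <= b ->
  lebesgue_measure.-integrable [set: R] (EFin \o beta_prime_density a b).
Proof.
move=> a0 b0; apply/integrableP; split.
  by apply/measurable_EFinP; exact: measurable_beta_prime_density.
under eq_integral do rewrite gee0_abs ?lee_fin ?beta_prime_density_ge0//.
by rewrite integral_beta_prime// ltry.
Qed.

(** * The Mittag-Leffler series *)

Definition ml_term {R : realType} (alpha x : R) (l : nat) : R :=
  x ^+ l / Gamma1 (alpha * l%:R).

Definition ml_series {R : realType} (alpha x : R) : nat -> R :=
  series (ml_term alpha x).

Definition ml {R : realType} (alpha x : R) : R := limn (ml_series alpha x).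

Lemma mittag_lefflerE (R : realType) (alpha x : R) :
  mittag_leffler alpha 1 x = ml alpha x.
Proof.
rewrite /mittag_leffler /ml /ml_series; congr (limn (series _)).
by apply/funext => l; rewrite /ml_term gamma_fun1D.
Qed.

Lemma Gamma1_alpha_gt0 (R : realType) (alpha : R) (l : nat) :
  0 < alpha -> 0 < Gamma1 (alpha * l%:R).
Proof. by move=> a0; rewrite Gamma1_gt0// mulr_ge0// ltW. Qed.

Lemma ml_term_ge0 (R : realType) (alpha x : R) (l : nat) :
  0 < alpha -> 0 <= x -> 0 <= ml_term alpha x l.
Proof.
by move=> a0 x0; rewrite /ml_term divr_ge0 ?exprn_ge0// ltW// Gamma1_alpha_gt0.
Qed.

Lemma norm_ml_term (R : realType) (alpha x : R) (l : nat) :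
  0 < alpha -> `|ml_term alpha x l| = ml_term alpha `|x| l.
Proof.
by move=> a0; rewrite /ml_term normrM normrX normfV (gtr0_norm (Gamma1_alpha_gt0 l a0)).
Qed.

(** [Gamma1_lower] is used with M^alpha = 2 (x + 1), which makes the terms
    smaller than a constant times 2^-l. *)
Lemma is_cvg_ml_series_ge0 (R : realType) (alpha x : R) :
  0 < alpha -> 0 <= x -> cvgn (ml_series alpha x).
Proof.
move=> a0 x0.
pose y : R := 2 * (x + 1).
have y0 : 0 < y by rewrite /y; lra.
pose M : R := y `^ alpha^-1.
have M0 : 0 < M by rewrite powR_gt0.
have Ma l : M `^ (alpha * l%:R) = y ^+ l.
  by rewrite /M -powRrM mulrA mulVf ?gt_eqF// mul1r powR_mulrn// ltW.
pose c := expR (- (M + 1)); have c0 : 0 < c by rewrite expR_gt0.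
apply: (@series_le_cvg _ _ (geometric c^-1 (2^-1 : R))).
- by move=> l; exact: ml_term_ge0.
- by move=> l; rewrite /geometric /= mulr_ge0 ?invr_ge0 ?exprn_ge0// ltW.
- move=> l; rewrite /geometric /= /ml_term.
  have h := @Gamma1_lower _ (alpha * l%:R) M (mulr_ge0 (ltW a0) (ler0n _ _)) M0.
  rewrite Ma -/c in h.
  apply: (@le_trans _ _ (x ^+ l / (y ^+ l * c))).
    rewrite ler_wpM2l ?exprn_ge0// lef_pV2// posrE ?Gamma1_alpha_gt0//.
    by rewrite mulr_gt0 ?exprn_gt0.
  rewrite invfM mulrA mulrC ler_wpM2l ?invr_ge0 ?(ltW c0)//.
  rewrite -exprVn -exprMn lerXn2r ?nnegrE ?mulr_ge0 ?invr_ge0 ?(ltW y0)//.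
  by rewrite ler_pdivrMr// /y; lra.
- by apply: is_cvg_geometric_series; rewrite ger0_norm ?invr_ge0//; lra.
Qed.

Lemma is_cvg_ml_series (R : realType) (alpha x : R) :
  0 < alpha -> cvgn (ml_series alpha x).
Proof.
move=> a0; apply: normed_cvg; rewrite /normed_series_of.
rewrite (_ : (fun _ => _) = ml_term alpha `|x|).
  exact: is_cvg_ml_series_ge0.
by apply/funext => l; rewrite norm_ml_term.
Qed.

(** For x >= 0 all terms are nonnegative, and this remainder dominates the one at
    every y with |y| <= x. *)
Definition ml_tail {R : realType} (alpha x : R) (N : nat) : R :=
  ml alpha x - ml_series alpha x N.

Lemma ml_tail_cvg0 (R : realType) (alpha x : R) :
  0 < alpha -> ml_tail alpha x N @[N --> \oo] --> 0.
Proof.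
move=> a0; rewrite -(subrr (ml alpha x)).
by apply: cvgB; [exact: cvg_cst|exact: is_cvg_ml_series].
Qed.

Lemma ml_le_partial_sum (R : realType) (alpha x y : R) (N : nat) :
  0 < alpha -> `|y| <= x ->
  ml alpha y <= ml_series alpha y N + ml_tail alpha x N.
Proof.
move=> a0 yx; have x0 : 0 <= x by exact: le_trans yx.
apply: limr_le; first exact: is_cvg_ml_series.
near=> M.
have NM : (N <= M)%N by near: M; exact: nbhs_infty_ge.
have ndx : nondecreasing_seq (ml_series alpha x).
  by apply: nondecreasing_series => l _ _; exact: ml_term_ge0.
have h : ml_series alpha x M <= ml alpha x.
  by apply: nondecreasing_cvgn_le => //; exact: is_cvg_ml_series.
rewrite /ml_tail -lerBlDl; apply: le_trans (lerB h (lexx _)).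
rewrite /ml_series !sub_series_geq//; apply: ler_sum => l _.
apply: le_trans (ler_norm _) _; rewrite norm_ml_term//.
rewrite /ml_term ler_wpM2r ?invr_ge0 ?(ltW (Gamma1_alpha_gt0 l a0))//.
by rewrite lerXn2r ?nnegrE.
Unshelve. all: by end_near. Qed.

Opaque ml.

(** * Decay of the Mittag-Leffler function *)

(** In the variable u = 1 / (1 + v), the density of index alpha l is u^(alpha l)
    times the one of index 0. *)
Lemma beta_prime_density_expr (R : realType) (alpha b v : R) (l : nat) :
  0 <= v ->
  beta_prime_density (alpha * l%:R) b v =
  beta_prime_density 0 b v * ((1 + v) `^ (- alpha)) ^+ l.
Proof.
move=> v0; have v1 : 0 < 1 + v by rewrite ltr_pwDl.
rewrite /beta_prime_density -powR_mulrn ?powR_ge0// -powRrM.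
rewrite (_ : - (alpha * l%:R + b + 2) = - (0 + b + 2) + - alpha * l%:R); last by ring.
by rewrite powRD_gt0// !mulrA.
Qed.

(** The sum on the left is what the Beta integral makes of the power series:
    its coefficients have moved by m places. *)
Lemma ml_series_shift (R : realType) (alpha x : R) (m N : nat) :
  x ^+ m * \sum_(l < N) x ^+ l / Gamma1 (alpha * (l + m)%:R) =
  ml_series alpha x (N + m) - ml_series alpha x m.
Proof.
rewrite /ml_series sub_series_geq ?leq_addl//.
rewrite -[X in \sum_(X <= _ < _) _]add0n big_addn addnK big_mkord mulr_sumr.
by apply: eq_bigr => l _; rewrite /ml_term mulrA -exprD addnC.
Qed.

Section ml_decay.
Context {R : realType} (alpha : R) (m : nat).
Hypotheses (alpha0 : 0 < alpha) (m1 : 1 <= alpha * m%:R).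
Hypothesis ml_nonincr :
  forall x y : R, 0 <= y -> y <= x -> ml alpha (- x) <= ml alpha (- y).

Let b : R := alpha * m%:R - 1.
Let b0 : 0 <= b. Proof. by rewrite subr_ge0. Qed.
Let al0 l : 0 <= alpha * l%:R. Proof. by rewrite mulr_ge0// ltW. Qed.

Let Rintegral_beta (l : nat) :
  \int[lebesgue_measure]_v beta_prime_density (alpha * l%:R) b v =
  Gamma1 (alpha * l%:R) * Gamma1 b / Gamma1 (alpha * (l + m)%:R).
Proof.
have e : alpha * l%:R + b + 1 = alpha * (l + m)%:R by rewrite /b natrD; ring.
by rewrite /Rintegral (integral_beta_prime (al0 l) b0) e.
Qed.

Let integrable_beta (l : nat) (c : R) :
  lebesgue_measure.-integrable [set: R]
    (EFin \o (fun v => c * beta_prime_density (alpha * l%:R) b v)).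
Proof.
rewrite (_ : _ \o _ = fun v => (c%:E * (beta_prime_density (alpha * l%:R) b v)%:E)%E)//.
by apply: integrableZl => //; exact: integrable_beta_prime.
Qed.

(** Up to the common factor [Gamma1 b], both sides are integrals against the Beta
    density in u = 1 / (1 + v): the partial sum of E_alpha(-x u^alpha) is, up to the remainder, at least
    E_alpha(-x u^alpha), hence at least E_alpha(-x). *)
Lemma ml_le_shifted_sum (x : R) (N : nat) : 0 <= x ->
  (ml alpha (- x) - ml_tail alpha x N) / Gamma1 (alpha * m%:R) * Gamma1 0 <=
  \sum_(l < N) (- x) ^+ l / Gamma1 (alpha * (l + m)%:R).
Proof.
move=> x0; rewrite -(@ler_pM2r _ (Gamma1 b)) ?Gamma1_gt0//.
pose c l := (- x) ^+ l / Gamma1 (alpha * l%:R).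
pose e := ml alpha (- x) - ml_tail alpha x N.
have -> : (\sum_(l < N) (- x) ^+ l / Gamma1 (alpha * (l + m)%:R)) * Gamma1 b =
    \int[lebesgue_measure]_v (\sum_(l < N) c l * beta_prime_density (alpha * l%:R) b v).
  rewrite /Rintegral.
  under eq_integral do rewrite -sumEFin.
  rewrite integral_sum//= => [|l]; last exact: integrable_beta.
  rewrite -sum_fine/=; last first.
    by move=> l _; exact/integrable_fin_num/integrable_beta.
  rewrite mulr_suml; apply: eq_bigr => l _.
  rewrite -/(Rintegral _ _ _) RintegralZl//; last exact: integrable_beta_prime.
  rewrite (Rintegral_beta l) /c.
  rewrite -!mulrA.
  rewrite mulKf ?(gt_eqF (Gamma1_alpha_gt0 l alpha0))//.
  by rewrite (mulrC (Gamma1 b)).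
have -> : e / Gamma1 (alpha * m%:R) * Gamma1 0 * Gamma1 b =
    \int[lebesgue_measure]_v (e * beta_prime_density (alpha * 0%:R) b v).
  rewrite RintegralZl//; last exact: integrable_beta_prime.
  by rewrite Rintegral_beta add0n mulr0 -!mulrA (mulrC _^-1) -mulrA.
apply: le_Rintegral => //.
  rewrite (_ : _ \o _ = fun v =>
      \sum_(l < N) (c l * beta_prime_density (alpha * l%:R) b v)%:E).
    by apply: integrable_sum => // l _; exact: integrable_beta.
  by apply/funext => v /=; rewrite sumEFin.
move=> v _; case: (ltP 0 v) => v0; last first.
  rewrite big1 => [|l _]; by rewrite /beta_prime_density indic_le0// mul0r mulr0.
set u := (1 + v) `^ (- alpha).
have v1 : 0 < 1 + v by rewrite addr_gt0.
have u1 : u <= 1.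
  rewrite /u powRN invf_le1 ?powR_gt0//.
  have := @ler_powR _ (1 + v) _ 0 alpha (ltW alpha0).
  by rewrite powRr0; apply; rewrite lerDl ltW.
have u0 : 0 <= u by exact: powR_ge0.
have -> : \sum_(l < N) c l * beta_prime_density (alpha * l%:R) b v =
    ml_series alpha (- (x * u)) N * beta_prime_density 0 b v.
  rewrite /ml_series /series/= big_mkord mulr_suml; apply: eq_bigr => l _.
  rewrite beta_prime_density_expr ?ltW// -/u /c /ml_term -mulNr exprMn; ring.
rewrite mulr0 ler_wpM2r ?beta_prime_density_ge0// /e lerBlDr.
apply: le_trans (_ : ml alpha (- (x * u)) <= _).
  by apply: ml_nonincr; [exact: mulr_ge0|exact: ler_piMr].
apply: ml_le_partial_sum => //.
by rewrite normrN ger0_norm ?mulr_ge0// ler_piMr.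
Qed.

(** By [ml_series_shift], the shifted sum is (-x)^-m times the series without its
    first m terms; absolute values absorb the sign. *)
Lemma ml_mul_le (x : R) : 0 <= x ->
  x ^+ m * (ml alpha (- x) / Gamma1 (alpha * m%:R) * Gamma1 0) <=
  `|ml alpha (- x) - ml_series alpha (- x) m|.
Proof.
move=> x0.
have hl : (x ^+ m * ((ml alpha (- x) - ml_tail alpha x N)
     / Gamma1 (alpha * m%:R) * Gamma1 0)) @[N --> \oo] -->
   x ^+ m * (ml alpha (- x) / Gamma1 (alpha * m%:R) * Gamma1 0).
  rewrite -{2}(subr0 (ml alpha (- x))).
  apply: cvgMr; apply: cvgMl; apply: cvgMl; apply: cvgB; first exact: cvg_cst.
  exact: ml_tail_cvg0.
have hr : `|ml_series alpha (- x) (N + m) - ml_series alpha (- x) m| @[N --> \oo]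
    --> `|ml alpha (- x) - ml_series alpha (- x) m|.
  apply: cvg_norm; apply: cvgB; last exact: cvg_cst.
  by rewrite (cvg_shiftn m); exact: is_cvg_ml_series.
apply: (ler_cvg_to hl hr).
apply: nearW => N; rewrite -ml_series_shift.
rewrite normrM normrX normrN (ger0_norm x0) ler_wpM2l ?exprn_ge0//.
by apply: le_trans (ler_norm _); exact: ml_le_shifted_sum.
Qed.
End ml_decay.

(** By [ml_mul_le], x^m E_alpha(-x) is bounded by a constant times
    1 + (a polynomial of degree m - 1), that is O(x^(m-1)) for x >= 1. For x < 1
    the bound E_alpha(-x) <= 1 suffices. *)
Lemma ml_decay (R : realType) (alpha : R) : 0 < alpha ->
  (forall x y : R, 0 <= y -> y <= x -> ml alpha (- x) <= ml alpha (- y)) ->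
  (forall x : R, 0 <= x -> 0 <= ml alpha (- x) <= 1) ->
  exists2 C : R, 0 < C & forall x : R, 0 < x -> ml alpha (- x) <= C / x.
Proof.
move=> a0 mono bnd.
pose m := (Num.bound alpha^-1).+1.
have m1 : 1 <= alpha * m%:R.
  rewrite mulrC -ler_pdivrMr// mul1r.
  have : alpha^-1 < (Num.bound alpha^-1)%:R.
    by apply: archi_boundP; rewrite invr_ge0 ltW.
  by move=> /ltW h; apply: le_trans h _; rewrite ler_nat.
pose D : R := 1 + \sum_(l < m) (Gamma1 (alpha * l%:R))^-1.
have D1 : 1 <= D.
  by rewrite lerDl sumr_ge0// => l _; rewrite invr_ge0 ltW// Gamma1_alpha_gt0.
pose G : R := Gamma1 (alpha * m%:R) / Gamma1 0.
have g0 : 0 < Gamma1 (0 : R) by exact: Gamma1_gt0.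
have gm : 0 < Gamma1 (alpha * m%:R) by exact: Gamma1_alpha_gt0.
have G0 : 0 < G by exact: divr_gt0.
have DG0 : 0 < D * G by rewrite mulr_gt0// (lt_le_trans ltr01).
exists (D * G + 1) => [|x x0]; first by rewrite addr_gt0.
have /andP[E0 E1] := bnd x (ltW x0).
case: (leP x 1) => x1.
  apply: le_trans E1 _; rewrite ler_pdivlMr// mul1r.
  by apply: le_trans x1 _; rewrite lerDr ltW.
have h := ml_mul_le a0 m1 mono (ltW x0).
have h2 : `|ml alpha (- x) - ml_series alpha (- x) m| <= x ^+ m.-1 * D.
  apply: le_trans (ler_normB _ _) _; rewrite mulrDr mulr1 lerD//.
    by rewrite ger0_norm//; apply: le_trans E1 _; rewrite exprn_ege1// ltW.
  rewrite /ml_series /series/= big_mkord mulr_sumr.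
  apply: le_trans (ler_norm_sum _ _ _) _; apply: ler_sum => l _.
  rewrite norm_ml_term// normrN (gtr0_norm x0) /ml_term ler_wpM2r//.
    by rewrite invr_ge0 ltW// Gamma1_alpha_gt0.
  by rewrite ler_weXn2l ?ltW// -ltnS.
have {h h2} := le_trans h h2.
rewrite exprS -mulrA [x * _]mulrCA ler_pM2l ?exprn_gt0// => h.
have : x * ml alpha (- x) <= D * G.
  rewrite /G mulrA (ler_pdivlMr _ _ g0) -(ler_pdivrMr _ _ gm).
  by move: h; rewrite !mulrA (mulrAC _ (Gamma1 0)).
rewrite ler_pdivlMr// mulrC => h'; apply: le_trans h' _; by rewrite lerDl.
Qed.

(** * Geometric ergodicity of the discrete queue *)

Definition queue_step {R : realType} (p : R) (h : nat -> R) (k : nat) : R :=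
  p * h k.+1 + (1 - p) * h k.-1.

Definition queue_weight {R : realType} (p : R) (j : nat) : R :=
  (1 - p *+ 2) / (1 - p) * (p / (1 - p)) ^+ j.

(** The contraction rate p r + (1 - p) / r for the choice r = 1 / (2 p), which
    lies strictly between 1 and (1 - p) / p. *)
Definition queue_rate {R : realType} (p : R) : R := 2^-1 + 2 * p * (1 - p).

Definition queue_growth {R : realType} (p : R) (k : nat) : R :=
  \sum_(i < k) ((2 * p)^-1) ^+ i.

Section queue.
Context {R : realType} (p : R).
Hypotheses (p0 : 0 < p) (p2 : p < 1 / 2).

Local Notation T := (queue_step p).
Local Notation w := (queue_weight p).
Local Notation rho := (queue_rate p).
Local Notation r := ((2 * p)^-1).

Let q0 : 0 < 1 - p. Proof. by move: p2; lra. Qed.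
Let r1 : 1 < r. Proof. by rewrite invf_gt1; move: p0 p2; lra. Qed.
Let r0 : 0 < r. Proof. by rewrite invr_gt0; move: p0; lra. Qed.

Lemma queue_rate_gt0 : 0 < rho.
Proof. by rewrite /queue_rate addr_gt0// !mulr_gt0. Qed.

Lemma queue_rate_lt1 : rho < 1.
Proof.
have q2 : 0 < 1 - 2 * p by move: p2; lra.
rewrite -subr_gt0 (_ : 1 - rho = (1 - 2 * p) ^+ 2 / 2).
  by rewrite divr_gt0 ?exprn_gt0.
by rewrite /queue_rate; field.
Qed.

Lemma queue_weight_ge0 j : 0 <= w j.
Proof.
have h : 0 <= 1 - p *+ 2 by rewrite mulr2n; move: p2; lra.
by rewrite /queue_weight mulr_ge0 ?exprn_ge0 ?divr_ge0 ?(ltW q0) ?(ltW p0).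
Qed.

Lemma queue_step_bnd h : (forall k, 0 <= h k <= 1) ->
  forall k, 0 <= T h k <= 1.
Proof.
move=> h01 k; rewrite /queue_step.
have /andP[a1 a2] := h01 k.+1; have /andP[b1 b2] := h01 k.-1.
rewrite addr_ge0 ?mulr_ge0 ?(ltW q0) ?(ltW p0)//=.
have : p * h k.+1 <= p * 1 by rewrite ler_wpM2l// ltW.
have : (1 - p) * h k.-1 <= (1 - p) * 1 by rewrite ler_wpM2l// ltW.
by lra.
Qed.

Lemma queue_iter_bnd h n : (forall k, 0 <= h k <= 1) ->
  forall k, 0 <= iter n T h k <= 1.
Proof. by move=> h01; elim: n => //= n IH; exact: queue_step_bnd. Qed.

(** The increments of [T h] at k only involve those of h at k + 1 and k - 1,
    and at k = 0 the second one disappears (k.-1 = k): the walk followed by the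
    increments is killed there. *)
Lemma queue_step_contract h M : (forall k, `|h k.+1 - h k| <= M * r ^+ k) ->
  forall k, `|T h k.+1 - T h k| <= M * rho * r ^+ k.
Proof.
move=> hM k.
have M0 : 0 <= M.
  by have := hM 0%N; rewrite expr0 mulr1; apply: le_trans.
have pr : p * r = 2^-1 by field; rewrite gt_eqF.
have -> : T h k.+1 - T h k =
    p * (h k.+2 - h k.+1) + (1 - p) * (h k - h k.-1).
  by rewrite /queue_step /=; ring.
apply: le_trans (ler_normD _ _) _.
rewrite !normrM (gtr0_norm p0) (gtr0_norm q0).
have h1 : p * `|h k.+2 - h k.+1| <= M * 2^-1 * r ^+ k.
  apply: le_trans (ler_wpM2l (ltW p0) (hM _)) _.
  by rewrite exprS -pr le_eqVlt; apply/orP; left; apply/eqP; ring.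
have h2 : (1 - p) * `|h k - h k.-1| <= M * (2 * p * (1 - p)) * r ^+ k.
  case: k {h1} => [|k] /=.
    by rewrite subrr normr0 mulr0 !mulr_ge0 ?(ltW q0) ?(ltW p0)// exprn_ge0// ltW.
  apply: le_trans (ler_wpM2l (ltW q0) (hM _)) _.
  rewrite exprS le_eqVlt; apply/orP; left; apply/eqP.
  by field; rewrite gt_eqF.
by apply: le_trans (lerD h1 h2) _; rewrite -mulrDl -mulrDr.
Qed.

Lemma queue_iter_contract h n : (forall k, 0 <= h k <= 1) ->
  forall k, `|iter n T h k.+1 - iter n T h k| <= rho ^+ n * r ^+ k.
Proof.
move=> h01; elim: n => [|n IH] k /=; last first.
  by rewrite exprSr; exact: queue_step_contract.
rewrite expr0 mul1r; apply: le_trans (_ : 1 <= _); last first.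
  by rewrite exprn_ege1// ltW.
have /andP[a1 a2] := h01 k.+1; have /andP[b1 b2] := h01 k.
by rewrite ler_norml; apply/andP; split; lra.
Qed.

Lemma queue_iter_dist0 h n : (forall k, 0 <= h k <= 1) ->
  forall k, `|iter n T h k - iter n T h 0| <= rho ^+ n * queue_growth p k.
Proof.
move=> h01; elim=> [|k IH].
  by rewrite subrr normr0 /queue_growth big_ord0 mulr0.
rewrite /queue_growth big_ord_recr/= mulrDr [leRHS]addrC.
rewrite -(subrKA (iter n T h k)).
apply: le_trans (ler_normD _ _) _; apply: lerD; last exact: IH.
exact: queue_iter_contract.
Qed.

Lemma queue_growth_le k : queue_growth p k <= r ^+ k / (r - 1).
Proof.
have r10 : 0 < r - 1 by rewrite subr_gt0.
rewrite ler_pdivlMr// mulrC /queue_growth -subrX1.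
by rewrite lerBlDr lerDl.
Qed.

(** Detailed balance: the sum telescopes and only the flux through the edge
    N -- N+1 remains. *)
Lemma queue_balance h N :
  \sum_(j < N.+1) w j * T h j - \sum_(j < N.+1) w j * h j =
  w N * p * (h N.+1 - h N).
Proof.
elim: N => [|N IH].
  by rewrite !big_ord_recl !big_ord0 /= /queue_step /=; ring.
rewrite big_ord_recr [in X in _ - X]big_ord_recr/= opprD addrACA IH.
have -> : w N * p = w N.+1 * (1 - p).
  by rewrite /queue_weight exprS; field; rewrite gt_eqF.
by rewrite /queue_step/=; ring.
Qed.

(** Stationarity up to an error that vanishes as N grows, which allows
    computing with finite sums only. *)
Lemma queue_iter_balance h n N : (forall k, 0 <= h k <= 1) ->
  `|\sum_(j < N.+1) w j * iter n T h j - \sum_(j < N.+1) w j * h j|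
    <= n%:R * w N.
Proof.
move=> h01; elim: n => [|n IH]; first by rewrite subrr normr0 mul0r.
rewrite -(subrKA (\sum_(j < N.+1) w j * iter n T h j)) /=.
apply: le_trans (ler_normD _ _) _; rewrite -natr1 mulrDl mul1r [leRHS]addrC.
apply: lerD => //; rewrite queue_balance normrM (normrM (w N)).
rewrite (ger0_norm (queue_weight_ge0 N)) -mulrA ler_piMr ?queue_weight_ge0//.
rewrite mulr_ile1//; first by rewrite gtr0_norm//; move: p2; lra.
have /andP[a1 a2] := queue_iter_bnd n h01 N.+1.
have /andP[b1 b2] := queue_iter_bnd n h01 N.
by rewrite ler_norml; apply/andP; split; lra.
Qed.

Let s : R := p / (1 - p).
Let s0 : 0 <= s. Proof. by rewrite divr_ge0 ?ltW. Qed.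
Let s1 : s < 1. Proof. by rewrite ltr_pdivrMr//; move: p2; lra. Qed.
Let wE j : w j = (1 - s) * s ^+ j.
Proof.
rewrite /queue_weight /s (_ : (1 - p *+ 2) / (1 - p) = 1 - p / (1 - p))//.
by rewrite mulr2n; field; rewrite gt_eqF.
Qed.

Lemma cvg_queue_weight : w N @[N --> \oo] --> 0.
Proof.
rewrite -(mulr0 (1 - s)).
under eq_fun do rewrite wE.
by apply: cvgMr; apply: cvg_expr; rewrite ger0_norm.
Qed.

Lemma sum_queue_weight N : \sum_(j < N) w j = 1 - s ^+ N.
Proof.
under eq_bigr do rewrite wE.
by rewrite -mulr_sumr -opprB mulNr -subrX1 opprB.
Qed.

(** The ratio of the weights is p / (1 - p), that of the growth 1 / (2 p), and
    their product t = 1 / (2 (1 - p)) is below 1. *)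
Lemma sum_queue_growth : exists2 K : R, 0 <= K &
  forall N, \sum_(j < N) w j * queue_growth p j <= K.
Proof.
pose t := (2 * (1 - p))^-1.
have q2 : 0 < 2 * (1 - p) by move: q0; lra.
have t0 : 0 < t by rewrite invr_gt0.
have t1 : t < 1 by rewrite invf_lt1//; move: p2; lra.
have r10 : 0 < r - 1 by rewrite subr_gt0.
have s10 : 0 <= 1 - s by rewrite subr_ge0 ltW.
exists ((1 - s) / (r - 1) / (1 - t)).
  by rewrite !divr_ge0// ltW// subr_gt0.
move=> N.
apply: (@le_trans _ _ (\sum_(j < N) (1 - s) / (r - 1) * t ^+ j)).
  apply: ler_sum => j _.
  apply: le_trans (ler_wpM2l (queue_weight_ge0 _) (queue_growth_le _)) _.
  rewrite wE le_eqVlt; apply/orP; left; apply/eqP.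
  have -> : t = s * r by rewrite /s /t; field; rewrite !gt_eqF.
  by rewrite (exprMn _ s r) (mulrC (r ^+ j)) mulrACA.
rewrite -mulr_sumr ler_wpM2l ?divr_ge0 ?(ltW r10)//.
rewrite -[leRHS]mul1r ler_pdivlMr ?subr_gt0// mulrC -opprB mulNr -subrX1 opprB.
by rewrite lerBlDr lerDl exprn_ge0// ltW.
Qed.

(** L is the equilibrium mean of h, which is also that of [iter n T h] by
    stationarity. The latter function is nearly constant by
    [queue_iter_dist0], so that its values are close to its mean. *)
Lemma queue_geometric_ergodicity : exists2 K : R, 0 <= K &
  forall (h : nat -> R) (L : R), (forall k, 0 <= h k <= 1) ->
    \sum_(j < N) w j * h j @[N --> \oo] --> L ->
    forall n k, `|iter n T h k - L| <= rho ^+ n * (K + queue_growth p k).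
Proof.
have [K K0 hK] := sum_queue_growth.
exists K => // h L h01 hL n k.
have rn : 0 <= rho ^+ n by rewrite exprn_ge0// ltW// queue_rate_gt0.
suff h0 : `|L - iter n T h 0| <= rho ^+ n * K.
  rewrite -(subrKA (iter n T h 0)) mulrDr [leRHS]addrC.
  apply: le_trans (ler_normD _ _) _.
  by rewrite lerD ?queue_iter_dist0// distrC.
have c1 : (\sum_(j < N.+1) w j * iter n T h j) @[N --> \oo] --> L.
  have hL' : \sum_(j < N.+1) w j * h j @[N --> \oo] --> L.
    by rewrite (cvg_shiftS (fun N => \sum_(j < N) w j * h j)).
  have hd : (\sum_(j < N.+1) w j * iter n T h j - \sum_(j < N.+1) w j * h j)
      @[N --> \oo] --> 0.
    apply: norm_cvg0.
    have up : n%:R * w N @[N --> \oo] --> 0.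
      by rewrite -(mulr0 n%:R); apply: cvgMr; exact: cvg_queue_weight.
    apply: (squeeze_cvgr _ (cvg_cst 0) up); apply: nearW => N.
    by rewrite normr_ge0 queue_iter_balance.
  rewrite -[L]add0r.
  rewrite (_ : (fun N => _) = (fun N => \sum_(j < N.+1) w j * iter n T h j -
     \sum_(j < N.+1) w j * h j + \sum_(j < N.+1) w j * h j)).
    exact: cvgD.
  by apply/funext => N; rewrite subrK.
have c2 : (\sum_(j < N.+1) w j) * iter n T h 0 @[N --> \oo]
    --> (1 - 0) * iter n T h 0.
  have cs : (1 - s ^+ N.+1) @[N --> \oo] --> (1 - 0 : R).
    apply: cvgB; first exact: cvg_cst.
    rewrite (cvg_shiftS (fun N => s ^+ N)).
    by apply: cvg_expr; rewrite ger0_norm.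
  rewrite (_ : (fun N => _) = fun N => (1 - s ^+ N.+1) * iter n T h 0).
    by apply: cvgMl.
  by apply/funext => N; rewrite sum_queue_weight.
rewrite subr0 mul1r in c2.
have c3 : `|\sum_(j < N.+1) w j * iter n T h j -
    (\sum_(j < N.+1) w j) * iter n T h 0| @[N --> \oo] --> `|L - iter n T h 0|.
  by apply: cvg_norm; exact: cvgB.
have c4 : rho ^+ n * K @[_ --> \oo] --> rho ^+ n * K by exact: cvg_cst.
apply: (ler_cvg_to c3 c4); apply: nearW => N.
rewrite mulr_suml -sumrB; apply: le_trans (ler_norm_sum _ _ _) _.
apply: (@le_trans _ _ (\sum_(j < N.+1) rho ^+ n * (w j * queue_growth p j))).
  apply: ler_sum => j _; rewrite -mulrBr normrM ger0_norm ?queue_weight_ge0//.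
  by rewrite mulrCA ler_wpM2l ?queue_weight_ge0// queue_iter_dist0.
by rewrite -mulr_sumr ler_wpM2l.
Qed.
End queue.

(** * Marginals of the Markov chain *)

Lemma measurable_preimage_mfun d d' (T : measurableType d)
    (T' : measurableType d') (Y : {mfun T >-> T'}) (B : set T') :
  measurable B -> measurable (Y @^-1` B).
Proof.
by move=> mB; rewrite -[X in measurable X]setTI; exact: measurable_funPT.
Qed.

Lemma measurable_gt_mfun (R : realType) d (T : measurableType d)
    (Y : {mfun T >-> R}) (x : R) : measurable [set w | x < Y w].
Proof.
rewrite (_ : [set w | _] = Y @^-1` `]x, +oo[%classic).
  exact: measurable_preimage_mfun.
by apply/seteqP; split => w /=; rewrite in_itv/= andbT.
Qed.

Lemma measurable_geq_level d (T : measurableType d) (N : T -> nat) (k : nat) :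
  (forall n, measurable (N @^-1` [set n])) ->
  measurable [set w | (k <= N w)%N].
Proof.
move=> mN; rewrite (_ : [set w | _] =
    \bigcup_(n in [set n | (k <= n)%N]) (N @^-1` [set n])).
  by apply: bigcup_measurable => n _; exact: mN.
by apply/seteqP; split => [w kw|w [n /= kn ->]//]; exists (N w).
Qed.

Definition prob {R : realType} d (T : measurableType d) (P : probability T R)
  (A : set T) : R := fine (P A).

Section prob.
Context {R : realType} d (T : measurableType d) (P : probability T R).
Local Notation pr := (prob P).

Lemma probE A : measurable A -> P A = (pr A)%:E.
Proof. by move=> mA; rewrite /prob fineK// fin_num_measure. Qed.

Lemma prob_ge0 A : 0 <= pr A.
Proof. by rewrite /prob fine_ge0. Qed.

Lemma prob_le A B : measurable A -> measurable B -> A `<=` B -> pr A <= pr B.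
Proof.
by move=> mA mB AB; rewrite -lee_fin -!probE//; apply: le_measure; rewrite ?inE.
Qed.

Lemma prob_setT : pr setT = 1.
Proof. by rewrite /prob probability_setT. Qed.

Lemma prob_set0 : pr set0 = 0.
Proof. by rewrite /prob measure0. Qed.

Lemma prob_splitI A B : measurable A -> measurable B ->
  pr A = pr (A `&` B) + pr (A `&` ~` B).
Proof.
move=> mA mB; apply: EFin_inj; rewrite EFinD -!probE//.
- rewrite -measureU//; [by rewrite -setIUr setUv setIT|exact: measurableI| |].
    by apply: measurableI => //; exact: measurableC.
  by rewrite setIACA setICr setI0.
- by apply: measurableI => //; exact: measurableC.
- exact: measurableI.
Qed.

Lemma prob_level_sum (N : T -> nat) (A : set T) (M : nat) :
  (forall n, measurable (N @^-1` [set n])) -> measurable A ->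
  pr A = \sum_(n < M) pr (A `&` [set w | N w = n]) +
         pr (A `&` [set w | (M <= N w)%N]).
Proof.
move=> mN mA.
elim: M => [|M IH].
  rewrite big_ord0 add0r; congr prob.
  by apply/seteqP; split => [w Aw|w []].
rewrite IH big_ord_recr/= -addrA; congr (_ + _).
rewrite (prob_splitI _ (mN M)); last first.
  by apply: measurableI => //; exact: measurable_geq_level.
congr (_ + _); congr prob; apply/seteqP; split => w /=.
- by move=> [[]].
- by move=> [? NM]; split => //; split => //=; rewrite NM.
- move=> [[Aw Mw] NM]; split => //=; rewrite ltn_neqAle Mw andbT.
  by apply/eqP => MN; apply: NM.
- move=> [Aw Mw]; split; first by split => //; exact: ltnW.
  by move=> NM; rewrite NM ltnn in Mw.
Qed.

Lemma prob_level_ge_cvg0 (N : T -> nat) :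
  (forall n, measurable (N @^-1` [set n])) ->
  pr [set w | (M <= N w)%N] @[M --> \oo] --> 0.
Proof.
move=> mN.
have mge k := @measurable_geq_level _ _ N k mN.
have := @nonincreasing_cvg_mu _ _ _ P (fun M => [set w | (M <= N w)%N]).
have -> : \bigcap_M [set w | (M <= N w)%N] = set0.
  by apply/seteqP; split => // w /(_ (N w).+1 I)/=; rewrite ltnn.
rewrite measure0 => h; apply: fine_cvg; apply: h => //.
- by apply: le_lt_trans (probability_le1 _ (mge _)) _; rewrite ltry.
- by move=> n m nm; apply/subsetPset => w /=; exact: leq_trans.
Qed.
End prob.

Section markov.
Context {R : realType} d (T : measurableType d) (P : probability T R).
Variables (p : R) (mu0 : set nat -> \bar R) (Q : nat -> {mfun T >-> nat}).
Hypothesis QM : markov_chain P mu0 (queue_trans p) Q.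
Local Notation pr := (prob P).

Let path (n : nat) (x : nat -> nat) : set T :=
  [set w | forall i, (i <= n)%N -> Q i w = x i].

Let mQ n A : measurable (Q n @^-1` A).
Proof. exact: measurable_preimage_mfun. Qed.

Let mpath n x : measurable (path n x).
Proof.
rewrite (_ : path n x = \bigcap_(i in [set i | (i <= n)%N]) (Q i @^-1` [set x i])).
  by apply: bigcap_measurableType => i _; exact: mQ.
by apply/seteqP; split => [w h i|w h i] /h.
Qed.

Let extend (n : nat) (x : nat -> nat) (j i : nat) :=
  if (i <= n)%N then x i else j.

Let path_extend n x j :
  path n.+1 (extend n x j) = path n x `&` Q n.+1 @^-1` [set j].
Proof.
apply/seteqP; split => w /=.
  move=> h; split=> [i ni|]; first by rewrite h /extend ?ni// leqW.
  by rewrite h// /extend ltnn.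
move=> [h hn] i; rewrite leq_eqVlt => /orP[/eqP ->|].
  by rewrite /extend ltnn.
by rewrite ltnS => ni; rewrite /extend ni h.
Qed.

Let prob_path_extend n x j :
  pr (path n x `&` Q n.+1 @^-1` [set j]) = pr (path n x) * queue_trans p (x n) j.
Proof.
rewrite -path_extend; apply: EFin_inj; rewrite EFinM -!probE//.
rewrite /path (proj2 QM) /extend leqnn ltnn; congr (_ * _)%E; congr (P _).
by apply/seteqP; split => w h i ni; have := h i ni; rewrite ni.
Qed.

(** Induction on m, conditioning on the position at time n + 1. Only the two
    neighbours of x n matter: their probabilities add up to 1, so that the
    paths going elsewhere form a null event. *)
Lemma markov_prob_path (A : set nat) m n x :
  pr (path n x `&` Q (n + m) @^-1` A) =
  pr (path n x) * iter m (queue_step p) (\1_A) (x n).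
Proof.
elim: m n x => [|m IH] n x /=.
  rewrite addn0 indicE; case: (boolP (x n \in A)) => xA.
    rewrite mulr1; congr prob; apply/seteqP; split => [w []//|w h].
    by split => //=; rewrite h// -in_setE.
  rewrite mulr0 -(prob_set0 P); congr prob; apply/seteqP; split => // w [h /=].
  by rewrite h// => xnA; move/negP : xA; apply; rewrite in_setE.
set B := Q (n + m.+1) @^-1` A.
have mB : measurable B by exact: mQ.
set F := fun j => Q n.+1 @^-1` [set j].
have mF j : measurable (F j) by exact: mQ.
have mCF j : measurable (~` F j) by exact: measurableC.
set a := (x n).+1; set b := (x n).-1.
have ab : a != b by rewrite /a /b; case: (x n) => [|k]//=; lia.
have FB j : pr (path n x `&` F j `&` B) =
    pr (path n x) * queue_trans p (x n) j * iter m (queue_step p) (\1_A) j.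
  rewrite -path_extend /B -addSnnS IH path_extend prob_path_extend.
  by rewrite /extend ltnn.
have qa : queue_trans p (x n) a = p by rewrite /queue_trans eqxx.
have qb : queue_trans p (x n) b = 1 - p.
  by rewrite /queue_trans eq_sym -/a -/b (negbTE ab) eqxx.
have rest : pr (path n x `&` ~` F a `&` ~` F b) = 0.
  have h1 := prob_splitI P (mpath n x) (mF a).
  have h2 := prob_splitI P (measurableI _ _ (mpath n x) (measurableC (mF a))) (mF b).
  have h3 : path n x `&` ~` F a `&` F b = path n x `&` F b.
    apply/seteqP; split => [w [[]]//|w [h1' h2']]; split => //; split => // wa.
    by move/eqP : ab; apply; rewrite -wa -h2'.
  rewrite h3 in h2; move: h1 h2; rewrite !prob_path_extend qa qb; lra.
have mBp : measurable (B `&` path n x) by exact: measurableI.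
rewrite setIC (prob_splitI P mBp (mF a)).
rewrite (prob_splitI P (measurableI _ _ mBp (mCF a)) (mF b)).
have -> : pr (B `&` path n x `&` ~` F a `&` ~` F b) = 0.
  apply/eqP; rewrite eq_le prob_ge0 andbT -rest; apply: prob_le.
  - exact: (measurableI _ _ (measurableI _ _ mBp (mCF a)) (mCF b)).
  - exact: (measurableI _ _ (measurableI _ _ (mpath n x) (mCF a)) (mCF b)).
  - by move=> w [[[_ ?] ?] ?].
have -> : B `&` path n x `&` F a = path n x `&` F a `&` B.
  by rewrite -setIA setIC.
have -> : B `&` path n x `&` ~` F a `&` F b = path n x `&` F b `&` B.
  apply/seteqP; split => [w [[[? ?] ?] ?]//|w [[? h] ?]].
  split => //; split => // wa.
  by move/eqP : ab; apply; rewrite -wa -h.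
by rewrite !FB qa qb addr0 /queue_step; ring.
Qed.

Lemma markov_prob0 (A : set nat) m k :
  pr (Q 0 @^-1` [set k] `&` Q m @^-1` A) =
  pr (Q 0 @^-1` [set k]) * iter m (queue_step p) (\1_A) k.
Proof.
have := @markov_prob_path A m 0 (fun=> k).
rewrite (_ : path 0 (fun=> k) = Q 0 @^-1` [set k])//.
apply/seteqP; split => [w h|w h i]; first exact: (h 0).
by rewrite leqn0 => /eqP ->.
Qed.

(** The law at time m is the average over the initial state k of the values
    [iter m (queue_step p) \1_A k]. *)
Lemma queue_marginal_bound (A : set nat) (K : nat) (L e : R) (m : nat) :
  (forall k, (K <= k)%N -> mu0 [set k] = 0%E) ->
  (forall k, (k < K)%N -> `|iter m (queue_step p) (\1_A) k - L| <= e) ->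
  `|pr (Q m @^-1` A) - L| <= e.
Proof.
move=> mu0K he.
have nul : pr [set w | (K <= Q 0 w)%N] = 0.
  rewrite /prob (@measure_negligible _ _ _ P)//.
    by apply: measurable_geq_level => n; exact: mQ.
  apply: (@negligibleS _ _ _ P
    (\bigcup_k (if (K <= k)%N then Q 0 @^-1` [set k] else set0))).
    by move=> w /= Kw; exists (Q 0 w) => //; rewrite Kw.
  apply: negligible_bigcup => k; case: ifPn => [Kk|_]; last exact: negligible_set0.
  apply/negligibleP; first exact: mQ.
  exact: eq_trans (proj1 QM k) (mu0K k Kk).
have nul' B : measurable B -> pr (B `&` [set w | (K <= Q 0 w)%N]) = 0.
  move=> mB; apply/eqP; rewrite eq_le prob_ge0 andbT -nul.
  have mK : measurable [set w | (K <= Q 0 w)%N].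
    by apply: measurable_geq_level => n; exact: mQ.
  by apply: prob_le; [exact: measurableI|exact: mK|exact: subIsetr].
have mQ0 n : measurable (Q 0 @^-1` [set n]) by exact: mQ.
have h1 := prob_level_sum P K mQ0 measurableT.
rewrite nul'// addr0 prob_setT in h1.
rewrite (prob_level_sum P K mQ0 (mQ m A)) nul'// addr0.
have -> : L = \sum_(n < K) pr (setT `&` [set w | Q 0 w = n]) * L.
  by rewrite -mulr_suml -h1 mul1r.
rewrite -sumrB; apply: le_trans (ler_norm_sum _ _ _) _.
rewrite -[leRHS]mul1r h1 mulr_suml; apply: ler_sum => k _.
rewrite setTI setIC markov_prob0 -mulrBr normrM ger0_norm ?prob_ge0//.
by rewrite ler_wpM2l ?prob_ge0// he.
Qed.
End markov.

(** * The renewal process *)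

(** For k > 0 the event says that the set of indices is one of the countably
    many finite sets of cardinality k. The level 0, which also collects the
    infinite sets, is the complement of all the others. *)
Lemma measurable_card_fset_set d (T : measurableType d) (E : nat -> set T)
    (k : nat) : (forall n, measurable (E n)) ->
  measurable [set w | #|` fset_set [set n | E n w]|%fset = k].
Proof.
move=> mE.
have mS j : measurable [set w | #|` fset_set [set n | E n w]|%fset = j.+1].
  pose F (J : {fset nat}) : set T := if #|` J|%fset == j.+1 then
    \bigcap_n (if n \in J then E n else ~` E n) else set0.
  rewrite (_ : [set w | _] = \bigcup_J F J).
    apply: countable_bigcupT_measurable; first exact: countableP.
    move=> J; rewrite /F; case: ifP => // _.
    apply: bigcapT_measurable => n; case: ifP => // _; exact: measurableC.
  apply/seteqP; split => [w /= hw|w [J _]].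
    have fin : finite_set [set n | E n w].
      by apply: contrapT => inf; move: hw; rewrite /fset_set; case: pselect.
    exists (fset_set [set n | E n w]) => //; rewrite /F hw eqxx => n _.
    by rewrite in_fset_set//; case: ifPn; rewrite ?inE ?notin_setE.
  rewrite /F; case: ifP => // /eqP Jj hw /=.
  rewrite (_ : [set n | E n w] = [set` J]) ?set_fsetK//.
  apply/seteqP; split => n /=; have /= := hw n I; case: ifP => //.
case: k => [|k]; last exact: mS.
rewrite (_ : [set w | _] =
    ~` \bigcup_j [set w | #|` fset_set [set n | E n w]|%fset = j.+1]).
  by apply: measurableC; apply: bigcupT_measurable => j; exact: mS.
apply/seteqP; split => [w /= h0 [j _ /=]|w /= hw].
  by rewrite h0.
by case e : #|` _|%fset => [//|j]; exfalso; apply: hw; exists j.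
Qed.

Section renewal.
Context {R : realType} d (T : measurableType d) (P : probability T R).
Variables (X : nat -> {mfun T >-> R}) (g : R -> R).
Hypothesis X_gt0 : forall n, {ae P, forall w, 0 < X n w}.
Hypothesis X_tail : forall n x, 0 <= x -> P [set w | x < X n w] = (g x)%:E.
Hypothesis X_indep : mutually_independent P X.
Local Notation pr := (prob P).

Let mXgt n x : measurable [set w | x < X n w].
Proof. exact: measurable_gt_mfun. Qed.

Let mXle n x : measurable [set w | X n w <= x].
Proof.
rewrite (_ : [set w | _] = ~` [set w | x < X n w]); first exact: measurableC.
by apply/seteqP; split => w /=; rewrite leNgt => /negP.
Qed.

Lemma measurable_renewal_sum n t :
  measurable [set w | \sum_(i < n) X i w <= t].
Proof.
rewrite (_ : [set w | _] = (fun w => \sum_(i < n) X i w) @^-1` `]-oo, t]%classic).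
  rewrite -[X in measurable X]setTI.
  have : measurable_fun setT (fun w => \sum_(i < n) X i w).
    by apply: measurable_sum => i; exact: measurable_funPT.
  by apply => //; exact: measurable_itv.
by apply/seteqP; split => w /=; rewrite in_itv.
Qed.

Lemma measurable_renewal_count t n :
  measurable (renewal_count X t @^-1` [set n]).
Proof.
by apply: measurable_card_fset_set => k; exact: measurable_renewal_sum.
Qed.

Let nonpos : set T := \bigcup_n [set w | X n w <= 0].

Let negligible_nonpos : P.-negligible nonpos.
Proof.
apply: negligible_bigcup => n; apply: negligibleS (X_gt0 n) => w /= Xw h.
by have := h; rewrite ltNge Xw.
Qed.

Lemma exists_positive_level : exists2 c : R, 0 < c & 0 < g c.
Proof.
have g0 : g 0 = 1.
  have h : P (~` [set w | 0 < X 0 w]) = 0.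
    apply: measure_negligible; first exact: measurableC.
    by apply: negligibleS (X_gt0 0) => w /= h h'; exact: h.
  have : 0 = 1 - g 0.
    by apply: EFin_inj; rewrite EFinB -(X_tail 0 (lexx 0)) -probability_setC ?h.
  by lra.
apply: contrapT => hc.
have gle c : 0 < c -> P [set w | c < X 0 w] = 0.
  move=> c0; rewrite (X_tail 0 (ltW c0)); congr EFin; apply/eqP.
  rewrite eq_le -[X in _ && X]lee_fin -(X_tail 0 (ltW c0)) measure_ge0 andbT.
  by rewrite leNgt; apply/negP => gc; apply: hc; exists c.
have : P [set w | 0 < X 0 w] = 0.
  apply: measure_negligible; first exact: mXgt.
  apply: (@negligibleS _ _ _ P (\bigcup_j [set w | (j.+1%:R)^-1 < X 0 w])).
    move=> w /= Xw; have /ltr_add_invr[k] := Xw.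
    by rewrite add0r => h; exists k.
  by apply: negligible_bigcup => j; apply/negligibleP => //; exact: gle.
by rewrite (X_tail 0 (lexx 0)) g0 => /eqP; rewrite onee_eq0.
Qed.

Let bounded_from (c : R) (K : nat) : set T :=
  \bigcap_(i in [set i | (K <= i)%N]) [set w | X i w <= c].

Let mbounded_from c K : measurable (bounded_from c K).
Proof. by apply: bigcap_measurableType => i _; exact: mXle. Qed.

(** Independence is used for finitely many waiting times only, those of ranks
    K, ..., K + n - 1. *)
Let prob_bounded_from (c : R) (K n : nat) : 0 < c ->
  pr (bounded_from c K) <= (1 - g c) ^+ n.
Proof.
move=> c0.
pose J : {fset nat} := [fset i in iota K n]%fset.
have le1 i : P (X i @^-1` `]-oo, c]%classic) = (1 - g c)%:E.
  rewrite (_ : _ @^-1` _ = ~` [set w | c < X i w]).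
    by rewrite probability_setC// (X_tail i (ltW c0)) EFinB.
  by apply/seteqP; split => w /=; rewrite in_itv/= leNgt => /negP.
have := X_indep J (fun=> measurable_itv `]-oo, c]).
under [in RHS]eq_bigr do rewrite le1.
rewrite prodEFin big_const_seq count_predT.
rewrite card_fseq undup_id ?iota_uniq// size_iota iter_mulr_1.
move=> hJ; rewrite -lee_fin -hJ -probE//; apply: le_measure; rewrite ?inE//.
  apply: fin_bigcap_measurable => // i _.
  exact: measurable_preimage_mfun.
move=> w hw i /=; rewrite inE/= mem_iota => /andP[Ki _].
rewrite in_itv/=; exact: hw.
Qed.

(** Infinitely many renewals before t: the series of waiting times converges,
    so its terms are eventually below the level c of [exists_positive_level].
    This has to be excluded because the count is then 0 by convention. *)
Let negligible_bounded (t : R) :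
  P.-negligible [set w | forall n, \sum_(i < n.+1) X i w <= t].
Proof.
have [c c0 gc] := exists_positive_level.
have gc1 : g c <= 1.
  by rewrite -lee_fin -(X_tail 0 (ltW c0)) probability_le1.
apply: (@negligibleS _ _ _ P (nonpos `|` \bigcup_K bounded_from c K)); last first.
  apply: negligibleU => //; apply: negligible_bigcup => K.
  suff h0 : P (bounded_from c K) = 0 by apply/negligibleP.
  rewrite probE//; congr EFin.
  apply/eqP; rewrite eq_le prob_ge0 andbT.
  have h : (1 - g c) ^+ n @[n --> \oo] --> 0.
    by apply: cvg_expr; rewrite ger0_norm ?subr_ge0// ltrBlDr ltrDl.
  apply: (@ler_cvg_to _ _ _ _ (fun=> pr (bounded_from c K)) _ _ _ (cvg_cst _) h).
  by apply: nearW => n; exact: prob_bounded_from.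
move=> w /= hw; case: (pselect (nonpos w)) => [|wpos]; [by left|right].
have pos i : 0 < X i w.
  by rewrite ltNge; apply/negP => h; apply: wpos; exists i.
have cv : cvgn (series (fun i => X i w)).
  apply: nondecreasing_is_cvgn.
    by apply: nondecreasing_series => i _ _; exact: ltW.
  exists t => _ [n _ <-]; rewrite /series/= big_mkord.
  apply: le_trans (hw n); rewrite big_ord_recr/= lerDl; exact: ltW.
have /cvgrPdist_lt/(_ c c0)[K _ hK] := cvg_series_cvg_0 cv.
exists K => // i /= Ki; have := hK i Ki.
by rewrite /= sub0r normrN gtr0_norm// => /ltW.
Qed.

Lemma renewal_count_ge w t n : (forall i, 0 < X i w) ->
  \sum_(i < n.+1) X i w <= t ->
  (exists k, t < \sum_(i < k.+1) X i w) -> (n < renewal_count X t w)%N.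
Proof.
move=> pos Sn [k Sk].
have mono i j : (i <= j)%N -> \sum_(l < i) X l w <= \sum_(l < j) X l w.
  move=> ij; rewrite -!(big_mkord xpredT (fun l => X l w)).
  by rewrite (big_cat_nat (leq0n i) ij)//= lerDl sumr_ge0// => l _; exact: ltW.
have fin : finite_set [set n : nat | \sum_(i < n.+1) X i w <= t].
  apply: (@sub_finite_set _ _ `I_k); last exact: finite_II.
  move=> j /= Sj; rewrite ltnNge; apply/negP => kj.
  have : \sum_(i < k.+1) X i w <= \sum_(i < j.+1) X i w by exact: mono.
  by rewrite leNgt (le_lt_trans Sj Sk).
rewrite /renewal_count; apply: leq_card_fset_set => //.
apply: subset_card_le => j /=; rewrite ltnS => jn.
by apply: le_trans Sn; exact: mono.
Qed.

(** Outside a null event, N(t) = n implies that the (n+1)-th renewal occurs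
    after t, hence that one of the first n + 1 waiting times exceeds t / (n+1). The
    union bound over these waiting times follows. *)
Lemma prob_renewal_count_le (t : R) (n : nat) : 0 <= t ->
  pr (renewal_count X t @^-1` [set n]) <= n.+1%:R * g (t / n.+1%:R).
Proof.
move=> t0.
set y := t / n.+1%:R; have y0 : 0 <= y by rewrite divr_ge0.
set B := [set w | forall n, \sum_(i < n.+1) X i w <= t].
set U := \big[setU/set0]_(i < n.+1) [set w | y < X i w].
have mU : measurable U by apply: bigsetU_measurable => i _; exact: mXgt.
have mB : measurable B.
  rewrite (_ : B = \bigcap_n [set w | \sum_(i < n.+1) X i w <= t]).
    by apply: bigcapT_measurable => k; exact: measurable_renewal_sum.
  by apply/seteqP; split => [w h k _|w h k]; [exact: h|exact: (h k I)].
have mnp : measurable nonpos by apply: bigcupT_measurable => k; exact: mXle.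
have mN := measurable_renewal_count t n.
rewrite -lee_fin -probE//.
have sub : renewal_count X t @^-1` [set n] `<=` U `|` (nonpos `|` B).
  move=> w /= Nw.
  case: (pselect (nonpos w)) => [|wpos]; first by right; left.
  case: (pselect (B w)) => [|nB]; first by right; right.
  left; rewrite /U -(bigcup_mkord n.+1 (fun i => [set w | y < X i w])).
  have pos i : 0 < X i w.
    by rewrite ltNge; apply/negP => h; apply: wpos; exists i.
  have ex : exists k, t < \sum_(i < k.+1) X i w.
    move/existsNP : nB => [k /negP]; rewrite -ltNge => h; by exists k.
  apply: contrapT => nU.
  have Sn : \sum_(i < n.+1) X i w <= t.
    have -> : t = \sum_(i < n.+1) y.
      by rewrite sumr_const card_ord /y -[RHS]mulr_natr divfK.
    apply: ler_sum => i _; rewrite leNgt; apply/negP => h.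
    by apply: nU; exists i => //=.
  by have := renewal_count_ge pos Sn ex; rewrite Nw ltnn.
apply: (@le_trans _ _ (P (U `|` (nonpos `|` B)))).
  by apply: le_measure; rewrite ?inE//; do 2 apply: measurableU => //.
have nul : P (nonpos `|` B) = 0.
  apply: measure_negligible; first exact: measurableU.
  by apply: negligibleU => //; exact: negligible_bounded.
have : (P (U `|` (nonpos `|` B)) <= P U + P (nonpos `|` B))%E.
  by apply: measureU2 => //; exact: measurableU.
rewrite nul adde0 => /le_trans; apply.
have : (P U <= \sum_(i < n.+1) P [set w | (y < X i w)%R])%E.
  by apply: (@Boole_inequality _ _ _ P (fun i => [set w | y < X i w])).
move=> /le_trans; apply.
rewrite (eq_bigr (fun=> (g y)%:E)) => [|i _]; last exact: X_tail.
by rewrite sumEFin sumr_const card_ord mulr_natl.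
Qed.
End renewal.

(** * Distance to equilibrium of the fractional queue *)

(** Summation by parts, twice: multiplying by 1 - x replaces n^2 by 2 n - 1, and
    then n by 1. *)
Lemma sum_sq_geometric_le (R : realFieldType) (x : R) (M : nat) :
  0 <= x -> x < 1 ->
  \sum_(n < M) n.+1%:R ^+ 2 * x ^+ n <= 2 / (1 - x) ^+ 3.
Proof.
move=> x0 x1; have y0 : 0 < 1 - x by rewrite subr_gt0.
rewrite ler_pdivlMr ?exprn_gt0//.
have h1 N : (1 - x) * \sum_(n < N) x ^+ n = 1 - x ^+ N.
  by rewrite -opprB mulNr -subrX1 opprB.
have h2 N : (1 - x) * \sum_(n < N) n.+1%:R * x ^+ n =
    \sum_(n < N) x ^+ n - N%:R * x ^+ N.
  elim: N => [|N IH]; first by rewrite !big_ord0; ring.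
  by rewrite !big_ord_recr/= mulrDr IH (exprS x N) -(natr1 N); ring.
have h3 N : (1 - x) * \sum_(n < N) n.+1%:R ^+ 2 * x ^+ n =
    2 * \sum_(n < N) n.+1%:R * x ^+ n - \sum_(n < N) x ^+ n - N%:R ^+ 2 * x ^+ N.
  elim: N => [|N IH]; first by rewrite !big_ord0; ring.
  by rewrite !big_ord_recr/= mulrDr IH (exprS x N) -(natr1 N); ring.
have := h3 M; have := h2 M; have := h1 M.
have : 0 <= \sum_(n < M) x ^+ n by rewrite sumr_ge0// => n _; exact: exprn_ge0.
set S0 := \sum_(n < M) _; set S1 := \sum_(n < M) _; set S2 := \sum_(n < M) _.
move=> S00 e1 e2 e3.
have -> : S2 * (1 - x) ^+ 3 = 2 * (1 - x ^+ M)
    - 2 * ((1 - x) * (M%:R * x ^+ M)) - (1 - x) * ((1 - x) * S0)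
    - (1 - x) * ((1 - x) * (M%:R ^+ 2 * x ^+ M)).
  transitivity ((1 - x) * ((1 - x) * ((1 - x) * S2))); first by ring.
  rewrite e3.
  transitivity (2 * ((1 - x) * ((1 - x) * S1)) - (1 - x) * ((1 - x) * S0)
    - (1 - x) * ((1 - x) * (M%:R ^+ 2 * x ^+ M))); first by ring.
  by rewrite e2 mulrBr e1; ring.
have xM : 0 <= x ^+ M by exact: exprn_ge0.
have a1 : 0 <= (1 - x) * (M%:R * x ^+ M) by rewrite !mulr_ge0// ltW.
have a2 : 0 <= (1 - x) * ((1 - x) * S0) by rewrite !mulr_ge0// ltW.
have a3 : 0 <= (1 - x) * ((1 - x) * (M%:R ^+ 2 * x ^+ M)).
  by rewrite !mulr_ge0 ?exprn_ge0// ltW.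
by lra.
Qed.

Lemma queue_equilibrium_lim (R : realType) (p : R) (A : set nat) :
  0 < p -> p < 1 / 2 ->
  exists L : R, [/\ 0 <= L, L <= 1, queue_equilibrium p A = L%:E &
    \sum_(j < N) queue_weight p j * \1_A j @[N --> \oo] --> L].
Proof.
move=> p0 p2.
pose u N := \sum_(j < N) queue_weight p j * \1_A j.
have t0 j : 0 <= queue_weight p j * \1_A j :> R.
  by rewrite mulr_ge0// queue_weight_ge0.
have le1 N : u N <= 1.
  apply: (@le_trans _ _ (\sum_(j < N) queue_weight p j)).
    apply: ler_sum => j _; apply: ler_piMr; first exact: queue_weight_ge0.
    by rewrite indicE lern1 leq_b1.
  rewrite sum_queue_weight// lerBlDr lerDl exprn_ge0// divr_ge0 ?ltW//.
  by rewrite subr_gt0; move: p2; lra.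
have cv : cvgn u.
  apply: nondecreasing_is_cvgn; last by exists 1 => _ [N _ <-].
  apply/nondecreasing_seqP => N; rewrite /u big_ord_recr/= lerDl//.
exists (limn u); split => //.
- apply: limr_ge => //; apply: nearW => N; exact: sumr_ge0.
- by apply: limr_le => //; apply: nearW.
rewrite /queue_equilibrium esum_mkcond -nneseries_esumT; last first.
  by move=> j; case: ifPn => // _; rewrite lee_fin queue_weight_ge0.
rewrite -EFin_lim//; congr (limn _); apply/funext => N /=.
rewrite /u -sumEFin big_mkord; apply: eq_bigr => j _.
rewrite indicE -/(queue_weight p j).
by case: ifPn; rewrite ?mulr1 ?mulr0.
Qed.

Lemma eventually_null (R : realType) (mu0 : probability nat R) :
  finite_set [set k : nat | mu0 [set k] != 0%E] ->
  exists K, forall k, (K <= k)%N -> mu0 [set k] = 0%E.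
Proof.
move=> fin; set S := fset_set [set k : nat | mu0 [set k] != 0%E].
exists (\max_(k <- S) k).+1 => k Kk; apply/eqP; apply: contraTT Kk => h.
rewrite -ltnNge ltnS; apply: (@leq_bigmax_seq _ (enum_fset S) xpredT id) => //.
by rewrite /S in_fset_set ?inE.
Qed.

Section tv_decay.
Context {R : realType} (alpha lambda p : R) (mu0 : probability nat R).
Hypotheses (alpha0 : 0 < alpha) (alpha1 : alpha <= 1) (lambda0 : 0 < lambda).
Hypotheses (p0 : 0 < p) (p2 : p < 1 / 2).
Variables (d : measure_display) (T : measurableType d) (P : probability T R).
Variables (X : nat -> {mfun T >-> R}) (Q : nat -> {mfun T >-> nat}).
Hypothesis XQ : fractional_queue_data alpha lambda p mu0 P X Q.

Let g (x : R) : R := ml alpha (- (lambda `^ alpha * x `^ alpha)).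

Lemma waiting_tail n x : 0 <= x -> P [set w | x < X n w] = (g x)%:E.
Proof.
move=> x0; have [hX _ _ _] := XQ.
by rewrite (proj2 (hX n))// mittag_lefflerE.
Qed.

Let power_scale_onto (y : R) : 0 <= y ->
  exists2 x, 0 <= x & y = lambda `^ alpha * x `^ alpha.
Proof.
move=> y0; exists (y `^ alpha^-1 / lambda).
  by rewrite divr_ge0 ?powR_ge0// ltW.
rewrite -powRM ?divr_ge0 ?powR_ge0 ?(ltW lambda0)//.
rewrite mulrC divfK ?gt_eqF// -powRrM mulVf ?gt_eqF// powRr1//.
Qed.

Let mgt x : measurable [set w | x < X 0 w].
Proof. exact: measurable_gt_mfun. Qed.

Lemma ml_bounded y : 0 <= y -> 0 <= ml alpha (- y) <= 1.
Proof.
move=> /power_scale_onto[x x0 ->]; rewrite -!lee_fin -/(g x) -(waiting_tail 0 x0).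
by rewrite measure_ge0 probability_le1.
Qed.

(** A tail function is nonincreasing, and x |-> (lambda x)^alpha maps the half
    line onto itself. *)
Lemma ml_nonincreasing y z : 0 <= z -> z <= y -> ml alpha (- y) <= ml alpha (- z).
Proof.
move=> z0 zy; have [x x0 xE] := power_scale_onto (le_trans z0 zy).
have [x' x'0 xE'] := power_scale_onto z0.
rewrite xE xE' -/(g x) -/(g x') -lee_fin -!(waiting_tail 0)//.
apply: le_measure; rewrite ?inE//; move=> w /=; apply: le_lt_trans.
rewrite leNgt; apply/negP => xx'.
have : lambda `^ alpha * x `^ alpha < lambda `^ alpha * x' `^ alpha.
  by rewrite ltr_pM2l ?powR_gt0// gt0_ltr_powR// ?nnegrE.
by rewrite -xE -xE' ltNge zy.
Qed.

Lemma prob_renewal_count_power_le (C t : R) (n : nat) :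
  (forall x : R, 0 < x -> ml alpha (- x) <= C / x) -> 0 <= C -> 0 < t ->
  prob P (renewal_count X t @^-1` [set n]) <=
  C / lambda `^ alpha * t `^ (- alpha) * n.+1%:R ^+ 2.
Proof.
move=> hC C0 t0; have [hX hI _ _] := XQ.
apply: le_trans (prob_renewal_count_le _ waiting_tail hI n (ltW t0)) _.
  by move=> k; exact: (proj1 (hX k)).
have n0 : 0 < n.+1%:R :> R by rewrite ltr0n.
have la0 : 0 < lambda `^ alpha by rewrite powR_gt0.
have ta0 : 0 < t `^ alpha by rewrite powR_gt0.
have na0 : 0 < n.+1%:R `^ alpha :> R by rewrite powR_gt0.
have tnE : (t / n.+1%:R) `^ alpha = t `^ alpha / n.+1%:R `^ alpha.
  rewrite powRM ?invr_ge0 ?(ltW t0)//.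
  by rewrite -[_^-1 in LHS]powR_inv1 ?(ltW n0)// -powRrM mulN1r powRN.
have h : g (t / n.+1%:R) <= C / (lambda `^ alpha * (t `^ alpha / n.+1%:R `^ alpha)).
  by rewrite /g tnE; apply: hC; rewrite mulr_gt0// divr_gt0.
apply: le_trans (ler_wpM2l (ltW n0) h) _.
have na1 : n.+1%:R `^ alpha <= n.+1%:R :> R.
  by rewrite ler1_powR// ler1n.
have -> : n.+1%:R * (C / (lambda `^ alpha * (t `^ alpha / n.+1%:R `^ alpha))) =
    C / lambda `^ alpha * (t `^ alpha)^-1 * (n.+1%:R * n.+1%:R `^ alpha) :> R.
  by field; rewrite ?gt_eqF.
rewrite powRN expr2; apply: ler_wpM2l; first by rewrite !mulr_ge0 ?invr_ge0// ltW.
by rewrite ler_pM2l.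
Qed.

(** On N(t) = n the queue is in state Q_n, independent of N(t). The sum is cut
    at n < M to keep it finite; the remaining mass P(N(t) >= M) tends to 0. *)
Lemma prob_fractional_queue_dist (A : set nat) (L C1 C2 t : R) :
  0 <= L -> L <= 1 -> 0 <= t -> 0 <= C1 -> 0 <= C2 ->
  (forall n, prob P (renewal_count X t @^-1` [set n]) <= C1 * n.+1%:R ^+ 2) ->
  (forall n, `|prob P (Q n @^-1` A) - L| <= C2 * queue_rate p ^+ n) ->
  measurable (fractional_queue X Q t @^-1` A) /\
  `|prob P (fractional_queue X Q t @^-1` A) - L| <=
    C1 * C2 * (2 / (1 - queue_rate p) ^+ 3).
Proof.
move=> L0 L1 t0 C10 C20 hN hQ; have [_ _ _ hI] := XQ.
set N := renewal_count X t; set B := _ @^-1` A.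
have mN n : measurable (N @^-1` [set n]) by exact: measurable_renewal_count.
have mQ n : measurable (Q n @^-1` A) by exact: measurable_preimage_mfun.
have BN n : B `&` [set w | N w = n] = Q n @^-1` A `&` N @^-1` [set n].
  apply/seteqP; split => w /= [h hn]; split => //; move: h.
  - by rewrite /B/= /fractional_queue -/(N w) hn.
  - by rewrite /B/= /fractional_queue -/(N w) hn.
have mB : measurable B.
  rewrite (_ : B = \bigcup_n (Q n @^-1` A `&` N @^-1` [set n])).
    by apply: bigcupT_measurable => n; exact: measurableI.
  apply/seteqP; split => [w Bw|w [n _]]; last by rewrite -BN => -[].
  by exists (N w) => //; rewrite -BN.
split => //.
have pBN n : prob P (B `&` [set w | N w = n]) =
    prob P (N @^-1` [set n]) * prob P (Q n @^-1` A).
  rewrite BN; apply: EFin_inj; rewrite mulrC EFinM -!probE//; last first.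
    exact: measurableI.
  apply: hI; apply: sub_sigma_algebra.
    by exists n; split => //; exists A.
  by exists t; split => //; exists [set n].
have rho0 := queue_rate_gt0 p0 p2; have rho1 := queue_rate_lt1 p2.
have key M : `|prob P B - L| <= C1 * C2 * (2 / (1 - queue_rate p) ^+ 3) +
    prob P [set w | (M <= N w)%N].
  have e1 := prob_level_sum P M mN mB.
  have e2 := prob_level_sum P M mN measurableT.
  have mge := @measurable_geq_level _ _ N M mN.
  have -> : prob P B - L =
      \sum_(n < M) prob P (N @^-1` [set (n : nat)]) * (prob P (Q n @^-1` A) - L) +
      (prob P (B `&` [set w | (M <= N w)%N]) - L * prob P [set w | (M <= N w)%N]).
    rewrite -{1}[L]mulr1 -(prob_setT P) e1 e2 mulrDr opprD addrACA setTI.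
    congr (_ + _); rewrite mulr_sumr -sumrB; apply: eq_bigr => n _.
    by rewrite pBN setTI; ring.
  apply: le_trans (ler_normD _ _) _; apply: lerD.
    apply: le_trans (ler_norm_sum _ _ _) _.
    apply: (@le_trans _ _ (\sum_(n < M) C1 * C2 * (n.+1%:R ^+ 2 * queue_rate p ^+ n))).
      apply: ler_sum => n _; rewrite normrM ger0_norm ?prob_ge0//.
      by apply: le_trans (ler_pM _ _ (hN n) (hQ n)) _; rewrite ?prob_ge0// mulrACA.
    rewrite -mulr_sumr; apply: ler_wpM2l; first exact: mulr_ge0.
    by apply: sum_sq_geometric_le => //; exact: ltW.
  have i1 : prob P (B `&` [set w | (M <= N w)%N]) <= prob P [set w | (M <= N w)%N].
    by apply: prob_le; [exact: measurableI|exact: mge|exact: subIsetr].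
  have i0 := prob_ge0 P (B `&` [set w | (M <= N w)%N]).
  have j0 := prob_ge0 P [set w | (M <= N w)%N].
  have j1 : L * prob P [set w | (M <= N w)%N] <= prob P [set w | (M <= N w)%N].
    exact: ler_piMl.
  have j2 : 0 <= L * prob P [set w | (M <= N w)%N] by exact: mulr_ge0.
  by rewrite ler_norml; apply/andP; split; lra.
have lim0 : C1 * C2 * (2 / (1 - queue_rate p) ^+ 3) + prob P [set w | (M <= N w)%N]
    @[M --> \oo] --> C1 * C2 * (2 / (1 - queue_rate p) ^+ 3) + 0.
  by apply: cvgD; [exact: cvg_cst|exact: prob_level_ge_cvg0].
rewrite addr0 in lim0.
have lim1 : `|prob P B - L| @[_ --> \oo] --> `|prob P B - L| by exact: cvg_cst.
by apply: (ler_cvg_to lim1 lim0); apply: nearW.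
Qed.
End tv_decay.

Theorem theorem3p4 (R : realType) (alpha lambda p : R)
    (mu0 : probability nat R) :
  0 < alpha -> alpha <= 1 -> 0 < lambda -> 0 < p -> p < 1 / 2 ->
  finite_set [set k : nat | mu0 [set k] != 0%E] ->
  exists eps0 U : R, 0 < eps0 /\ 0 < U /\
    forall (d : measure_display) (T : measurableType d) (P : probability T R)
      (X : nat -> {mfun T >-> R}) (Q : nat -> {mfun T >-> nat}),
      fractional_queue_data alpha lambda p mu0 P X Q ->
      forall eps : R, 0 < eps -> eps < eps0 ->
        (mixing_time (fun t : R => pushforward P (fractional_queue X Q t))
           (queue_equilibrium p) eps
         <= (U * eps `^ (- alpha^-1))%:E)%E.
Proof.
move=> a0 a1 l0 p0 p2 fin.
case: (pselect
  ((forall x y : R, 0 <= y -> y <= x -> ml alpha (- x) <= ml alpha (- y)) /\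
   (forall x : R, 0 <= x -> 0 <= ml alpha (- x) <= 1))); last first.
  move=> nope; exists 1, 1; split => //; split => // d T P X Q XQ.
  exfalso; apply: nope; split.
  - by move=> x y; exact: (ml_nonincreasing a0 l0 XQ).
  - by move=> x; exact: (ml_bounded a0 l0 XQ).
move=> [mono bnd].
have [C C0 hC] := ml_decay a0 mono bnd.
have [K K0 hK] := queue_geometric_ergodicity p0 p2.
have [Kmax hKmax] := eventually_null fin.
pose rho := queue_rate p.
have rho0 : 0 < rho := queue_rate_gt0 p0 p2.
have rho1 : rho < 1 := queue_rate_lt1 p2.
have growth0 k : 0 <= queue_growth p k.
  by rewrite sumr_ge0// => i _; rewrite exprn_ge0// invr_ge0 mulr_ge0// ltW.
pose C2 := K + \sum_(k < Kmax) queue_growth p k.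
have C20 : 0 <= C2 by rewrite addr_ge0// sumr_ge0.
have la0 : 0 < lambda `^ alpha by rewrite powR_gt0.
pose Z := 2 / (1 - rho) ^+ 3.
have Z0 : 0 <= Z by rewrite divr_ge0// exprn_ge0// subr_ge0 ltW.
(* the term 1 only makes U0 positive *)
pose U0 := C / lambda `^ alpha * C2 * Z + 1.
have CZ0 : 0 <= C / lambda `^ alpha * C2 * Z.
  by rewrite mulr_ge0// mulr_ge0// divr_ge0// ltW.
have U00 : 0 < U0 by rewrite ltr_wpDl.
exists 1, (U0 `^ alpha^-1); split => //; split; first exact: powR_gt0.
move=> d T P X Q XQ eps eps0 _.
(* the time at which U0 t^-alpha equals eps *)
pose t := U0 `^ alpha^-1 * eps `^ (- alpha^-1).
have t0 : 0 < t by rewrite mulr_gt0// powR_gt0.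
have tE : t `^ (- alpha) = eps / U0.
  rewrite /t powRM ?powR_ge0// -!powRrM mulrN mulrNN mulVf ?gt_eqF//.
  by rewrite powR_inv1 ?(ltW U00)// powRr1 ?(ltW eps0)// mulrC.
apply: ereal_inf_lbound; exists t => //; split => //.
apply: ub_ereal_sup => _ [A _ <-].
have [L [L0 L1 LE Llim]] := queue_equilibrium_lim A p0 p2.
have [hX hI hM hind] := XQ.
have t0' := ltW t0.
have C10 : 0 <= C / lambda `^ alpha * t `^ (- alpha).
  by rewrite mulr_ge0 ?powR_ge0// divr_ge0// ltW.
have hN n := prob_renewal_count_power_le a1 l0 XQ n hC (ltW C0) t0.
have hQ n : `|prob P (Q n @^-1` A) - L| <= C2 * rho ^+ n.
  apply: (queue_marginal_bound hM hKmax) => k kK.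
  have h01 j : 0 <= (\1_A : nat -> R) j <= 1.
    by rewrite indicE ler0n lern1 leq_b1.
  apply: le_trans (hK _ _ h01 Llim n k) _.
  rewrite mulrC ler_wpM2r ?exprn_ge0 ?(ltW rho0)// lerD2l.
  rewrite (bigD1 (Ordinal kK))//= lerDl; exact: sumr_ge0.
have [mB] := prob_fractional_queue_dist p0 p2 XQ L0 L1 t0' C10 C20 hN hQ.
rewrite /pushforward probE// LE -EFinB abse_EFin lee_fin => /le_trans; apply.
rewrite -/rho -/Z tE (mulrAC _ (eps / U0)) (mulrAC _ (eps / U0)) mulrA.
rewrite ler_pdivrMr// mulrC ler_pM2l// /U0.
by rewrite lerDl.
Qed.
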